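(* Let $K$ be a field and let $G$ be a finite simple bipartite graph with parts $V_1$ and $V_2$ and with no vertex of degree zero. Then $G$ is Cohen-Macaulay (over $K$) if and only if there is a perfect matching $\{x_1,y_1\},\ldots,\{x_n,y_n\}$ in $G$, with $x_i\in V_1$ and $y_i\in V_2$ for $i=1,\ldots,n$, such that the following two conditions hold: (1) for every $i=1,\ldots,n$, the induced subgraph of $G$ on $N(x_i)\cup N(y_i)$ is a complete bipartite graph (that is, every vertex of $N(y_i)$ is adjacent to every vertex of $N(x_i)$); (2) for all $i\neq j$, if $x_i\sim y_j$, then $x_j\not\sim y_i$.
   Context: For vertices $v,w$ of $G$, $v\sim w$ means that $v$ and $w$ are adjacent, and $N(v)$ is the set of all vertices adjacent to $v$. A perfect matching is a set of edges, no two distinct ones sharing a vertex, such that every vertex of $G$ belongs to one of these edges. For a graph $G$ on vertices $v_1,\ldots,v_m$, the edge ideal $I(G)$ is the ideal of $S=K[z_1,\ldots,z_m]$ generated by all monomials $z_iz_j$ with $v_i\sim v_j$, and the edge ring of $G$ is $R(G)=S/I(G)$. For a homogeneous ideal $I$ of $S$, $\operatorname{depth}(S/I)$ is the largest length of a regular sequence of homogeneous elements of positive degree on $S/I$, and $S/I$ is Cohen-Macaulay if $\operatorname{depth}(S/I)=\dim(S/I)$ (Krull dimension). The graph $G$ is called Cohen-Macaulay if $R(G)$ is a Cohen-Macaulay ring. *)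

(* Defs.v *)
(* Classical axioms (from boolp) serve only to turn ideals given by existential
   formulas into the boolean predicates that ring_quotient expects. *)
From HB Require Import structures.
From mathcomp Require Import all_boot all_algebra ring_quotient.
From mathcomp Require Import boolp.
From mathcomp Require Import mpoly.

Set Implicit Arguments.
Unset Strict Implicit.
Unset Printing Implicit Defensive.

Import GRing.Theory.
Local Open Scope ring_scope.
Local Open Scope quotient_scope.

Section CommutativeAlgebra.
Variable R : comNzRingType.
Implicit Types (A : {pred R}) (s : seq R) (d : nat).

(* Each pair in [c] is (coefficient, generator). *)
Definition ideal_gen A : {pred R} :=
  [pred x | `[< exists c : seq (R * R),
      {subset unzip2 c <= A} /\ x = \sum_(p <- c) p.1 * p.2 >]].

Lemma ideal_gen0 A : 0 \in ideal_gen A.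
Proof. by apply/asboolP; exists [::]; rewrite big_nil. Qed.

Lemma ideal_gen_lin A a : {in ideal_gen A &, forall u v, a * u + v \in ideal_gen A}.
Proof.
move=> u v /asboolP [c [cA ->]] /asboolP [c' [cA' ->]]; apply/asboolP.
exists ([seq (a * p.1, p.2) | p <- c] ++ c'); split=> [x|].
  rewrite /unzip2 map_cat -map_comp mem_cat => /orP [xc|]; last exact: cA'.
  exact: cA.
rewrite big_cat big_map mulr_sumr /=.
by congr (_ + _); apply: eq_bigr => p _; rewrite mulrA.
Qed.

(* [prime_idealr R] is the type of boolean prime (hence proper) ideals; with
   classical logic these are all the prime ideals of [R]. *)
Definition prime_chain d (P : 'I_d.+1 -> prime_idealr R) : Prop :=
  forall i j : 'I_d.+1, (i < j)%N ->
    {subset P i <= P j} /\ exists2 x, x \in P j & x \notin P i.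

Definition is_krull_dim d : Prop :=
  (exists P : 'I_d.+1 -> prime_idealr R, prime_chain P) /\
  (forall d' (P : 'I_d'.+1 -> prime_idealr R), prime_chain P -> (d' <= d)%N).

(* The first clause: the k-th term is a nonzerodivisor on the quotient of [R] by
   the previous ones; the second: the quotient by the whole sequence is nonzero. *)
Definition regular_seq s : Prop :=
  (forall k, (k < size s)%N -> forall g : R,
     s`_k * g \in ideal_gen (mem (take k s)) -> g \in ideal_gen (mem (take k s)))
  /\ 1 \notin ideal_gen (mem s).

End CommutativeAlgebra.

Section StandardGraded.
Variables (K : fieldType) (m : nat) (I : idealr {mpoly K[m]}).

Definition homog_pos (f : {mpoly K[m]}) : Prop :=
  exists2 d, (0 < d)%N & f \is d.-homog.

(* A sequence [s] in the polynomial ring is regular on the quotient by [I] iff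
   its image is, since [s] acts on the quotient through its image. *)
Definition homog_regular_seq (s : seq {mpoly K[m]}) : Prop :=
  (forall f, f \in s -> homog_pos f) /\
  regular_seq [seq \pi_({ideal_quot I}) f | f <- s].

(* Depth and dimension are stated as relations "the maximum exists and is [d]",
   so Cohen-Macaulayness below asserts that both are finite and equal. *)
Definition is_depth (d : nat) : Prop :=
  (exists2 s, homog_regular_seq s & size s = d) /\
  (forall s, homog_regular_seq s -> (size s <= d)%N).

Definition cohen_macaulay_quot : Prop :=
  exists2 d, is_depth d & is_krull_dim {ideal_quot I} d.

End StandardGraded.

Section Graph.
Variables (V : finType) (e : rel V).

Definition nbhd (v : V) : {set V} := [set w | e v w].

Definition bipartition (V1 V2 : {set V}) : Prop :=
  [/\ V1 :|: V2 = [set: V], [disjoint V1 & V2] &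
      forall u v, e u v ->
        (u \in V1) && (v \in V2) || (u \in V2) && (v \in V1)].

Definition perfect_matching (M : {set {set V}}) : Prop :=
  [/\ forall A, A \in M -> exists u v, e u v /\ A = [set u; v],
      forall A B, A \in M -> B \in M -> A != B -> [disjoint A & B] &
      forall v, exists2 A, A \in M & v \in A].

Variable K : fieldType.

Definition vertex_var (v : V) : {mpoly K[#|V|]} := 'X_(enum_rank v).

Definition edge_monomials : {pred {mpoly K[#|V|]}} :=
  [pred f | [exists u, exists v, e u v && (f == vertex_var u * vertex_var v)]].

Definition edge_ideal : {pred {mpoly K[#|V|]}} := ideal_gen edge_monomials.

Lemma edge_ideal_closed : idealr_closed edge_ideal.
Proof.
split; [exact: ideal_gen0 | | exact: ideal_gen_lin].
apply/negP => /asboolP [c [cA /(congr1 (mcoeff 0%MM))]].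
rewrite mcoeff1 eqxx raddf_sum big_seq big1 /=.
  by move/eqP; rewrite oner_eq0.
move=> p /(map_f snd) /cA /existsP [u /existsP [v /andP [_ /eqP ->]]].
rewrite !rmorphM /= [mcoeff _ (vertex_var u)]mcoeffX.
by rewrite mnm1_eq0 mul0r mulr0.
Qed.

HB.instance Definition _ :=
  isIdealr.Build {mpoly K[#|V|]} edge_ideal edge_ideal_closed.

Definition cohen_macaulay_graph : Prop := cohen_macaulay_quot edge_ideal.

End Graph.

(* Main.v *)
(* Say that [b] is nested in [f_0, ..., f_r] if it has the shape
   [f_0^k_0 * (f_1^k_1 * (... (1 + f_r * w_r) ...) + f_0 * w_0)]. Counting monomials
   shows that in [K[z_v : v in A]] the element 0 is nested in any [#|A| + 1] given
   elements; this bounds the length of chains of primes by the largest size of an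
   independent set. An element nested in a homogeneous regular sequence is a
   nonzerodivisor; applied to the ideal generated by the product of the variables
   in [A], this bounds the length of regular sequences by the size of every maximal
   independent set [A]. Hence a Cohen-Macaulay graph has all its maximal
   independent sets of the same size, and Hall's theorem gives the matching and
   (1). For (2), two pairs with [x_i ~ y_j] and [x_j ~ y_i] produce a fraction
   defined off a subspace of codimension at least 2 and not in the ring, which
   contradicts depth (Ischebeck's vanishing of Ext^1 in an elementary form).
   Conversely, (1) and (2) say that [x_i ~ y_j] is a partial order on the indices,
   and then the [x_i - y_i] form a regular sequence: each one is a nonzerodivisor
   modulo the monomial ideal obtained by identifying [x_j] with [y_j] for the
   previous [j]. *)
Require Import Defs.
From HB Require Import structures.
From mathcomp Require Import all_boot all_algebra ring_quotient.
From mathcomp Require Import boolp.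
From mathcomp Require Import mpoly.
From mathcomp Require Import ring zify.

Set Implicit Arguments.
Unset Strict Implicit.
Unset Printing Implicit Defensive.

Import GRing.Theory.

(** * Ideals as predicates, and nested elements *)

Section Ideals.
Local Open Scope ring_scope.
Variable R : comNzRingType.
Implicit Types (J c : R -> Prop) (f g b v : R) (fs : seq R).

(** Unlike [idealr], this allows the unit ideal, so a sum such as [J + (f)] needs no proof of
    properness. *)
Record is_ideal J : Prop := IsIdeal {
  ideal0 : J 0;
  idealD : forall x y, J x -> J y -> J (x + y);
  idealM : forall a x, J x -> J (a * x) }.

Lemma idealN J : is_ideal J -> forall x, J x -> J (- x).
Proof. by move=> JI x Jx; rewrite -mulN1r; apply: idealM. Qed.

Lemma idealB J : is_ideal J -> forall x y, J x -> J y -> J (x - y).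
Proof. by move=> JI x y Jx Jy; apply: idealD => //; apply: idealN. Qed.

Lemma ideal_sum J : is_ideal J -> forall (T : eqType) (r : seq T) (F : T -> R),
  (forall i, i \in r -> J (F i)) -> J (\sum_(i <- r) F i).
Proof.
move=> JI T r F JF; rewrite big_seq; elim/big_ind: _ => //.
  exact: ideal0.
exact: idealD.
Qed.

Definition adj J f : R -> Prop := fun x => exists w, J (x - f * w).

Lemma adj_ideal J f : is_ideal J -> is_ideal (adj J f).
Proof.
move=> JI; split=> [|x y [w Jx] [z Jy]|a x [w Jx]].
- by exists 0; rewrite mulr0 subr0; apply: ideal0.
- exists (w + z).
  have -> : x + y - f * (w + z) = (x - f * w) + (y - f * z) by ring.
  exact: idealD.
- exists (a * w); have -> : a * x - f * (a * w) = a * (x - f * w) by ring.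
  exact: idealM.
Qed.

Lemma adj_sub J f x : J x -> adj J f x.
Proof. by exists 0; rewrite mulr0 subr0. Qed.

Lemma adj_gen J f w : is_ideal J -> adj J f (f * w).
Proof. by exists w; rewrite subrr; apply: ideal0. Qed.

(** Properness is kept apart from regularity, and the recursion runs from the front to match
    [nested]. *)
Fixpoint reg J fs : Prop :=
  if fs is f :: fs' then
    (forall g, J (f * g) -> J g) /\ reg (adj J f) fs'
  else True.

Lemma nzd_expr J f k : (forall g, J (f * g) -> J g) ->
  forall g, J (f ^+ k * g) -> J g.
Proof.
move=> fJ; elim: k => [|k IH] g; first by rewrite expr0 mul1r.
by rewrite exprS -mulrA => /fJ; apply: IH.
Qed.

(* A polynomial in [f_0, ..., f_r] which is nonzero, up to a scalar, can be
   written [f_0^k_0 * (f_1^k_1 * (... (1 + f_r * w_r) ...) + f_0 * w_0)] by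
   factoring out its lexicographically least monomial; only this shape is kept,
   and the [w_i] are arbitrary. *)
Inductive nested : seq R -> R -> Prop :=
| nested_nil : nested [::] 1
| nested_cons f fs k b w :
    nested fs b -> nested (f :: fs) (f ^+ k * (b + f * w)).

Lemma nested_nilE b : nested [::] b -> b = 1.
Proof. by move=> nb; inversion nb. Qed.

Lemma nested_consE f fs b : nested (f :: fs) b ->
  exists k b' w, b = f ^+ k * (b' + f * w) /\ nested fs b'.
Proof. by move=> nb; inversion nb; do 3!eexists; split. Qed.

(* The quotient by [c] has no [k] algebraically independent elements. *)
Definition small c k : Prop :=
  forall gs, size gs = k -> exists2 b, c b & nested gs b.

(** Take an element of [c] nested in [f :: gs]: the power of [f] cancels modulo [c], and what
    remains is nested in [gs] up to a multiple of [f]. This is the drop of dimension by one modulo a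
    nonzerodivisor. *)
Lemma small_adj c f k : is_ideal c -> (forall g, c (f * g) -> c g) ->
  small c k.+1 -> small (adj c f) k.
Proof.
move=> cI fc csm gs szg; have [|b cb nb] := csm (f :: gs); first by rewrite /= szg.
have [k' [b' [w [bE nb']]]] := nested_consE nb; move: cb; rewrite {}bE.
move=> /(nzd_expr fc) cb; exists b' => //; exists (- w).
by rewrite mulrN opprK.
Qed.

(** Each step up the chain peels one layer of [b]: the power of the current entry cancels modulo the
    current ideal, and its multiple vanishes modulo the next one. The innermost layer is 1. *)
Lemma nested_chain (P : nat -> R -> Prop) gs b i :
    (forall j, is_ideal (P j)) -> (forall j x, P j x -> P j.+1 x) ->
    (forall j, (j < size gs)%N -> P (i + j).+1 gs`_j /\
       forall x, P (i + j)%N (gs`_j * x) -> P (i + j)%N x) ->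
  nested gs b -> P i b -> P (i + size gs)%N 1.
Proof.
move=> PI Pinc Pgs nb; elim: nb i Pgs => [|f fs k b' w nb IH] i Pgs /=.
  by rewrite addn0.
have [] := Pgs 0%N isT; rewrite addn0 /= => Pf fP /(nzd_expr fP) /Pinc Pb.
rewrite addnS -addSn; apply: IH => [j ltj|]; first by rewrite addSnnS; apply: Pgs.
have -> : b' = (b' + f * w) - w * f by ring.
by apply: idealB => //; apply: idealM.
Qed.

Definition saturation c f : R -> Prop := fun t => exists k, c (f ^+ k * t).

Lemma saturation_ideal c f : is_ideal c -> is_ideal (saturation c f).
Proof.
move=> cI; split=> [|x y [k cx] [l cy]|a x [k cx]].
- by exists 0%N; rewrite mulr0; apply: ideal0.
- exists (k + l)%N.
  have -> : f ^+ (k + l) * (x + y) = f ^+ l * (f ^+ k * x) + f ^+ k * (f ^+ l * y).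
    by rewrite exprD; ring.
  by apply: idealD => //; apply: idealM.
- by exists k; rewrite mulrCA; apply: idealM.
Qed.

Lemma saturation_nzd c f g : saturation c f (f * g) -> saturation c f g.
Proof. by case=> k; rewrite mulrA -exprSr => cg; exists k.+1. Qed.

End Ideals.

(** * Homogeneous ideals and homogeneous regular sequences *)

Section Graded.
Local Open Scope ring_scope.
Variables (K : fieldType) (m : nat).
Local Notation S := {mpoly K[m]}.
Implicit Types (J c : S -> Prop) (f g b v : S) (fs : seq S).

Definition is_hideal J : Prop :=
  is_ideal J /\ forall d f, J f -> J (pihomog mdeg d f).

Lemma pihomogM_homog e d f g : f \is e.-homog ->
  pihomog mdeg (e + d) (f * g) = f * pihomog mdeg d g.
Proof.
move=> fe; pose N := (mmeasure mdeg g + d).+1.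
have leN : (mmeasure mdeg g <= N)%N by rewrite /N; lia.
have ltd : (d < N)%N by rewrite /N; lia.
rewrite [in LHS](pihomog_partitionE leN) mulr_sumr raddf_sum /=.
rewrite (bigD1 (Ordinal ltd)) //= pihomog_dE; last exact: dhomogM (pihomogP _ _ _).
rewrite big1 ?addr0 // => i neq.
apply: pihomog_ne0 (dhomogM fe (pihomogP mdeg i g)).
by rewrite eqn_add2l.
Qed.

Lemma pihomogM_lt e d f g : f \is e.-homog -> (d < e)%N ->
  pihomog mdeg d (f * g) = 0.
Proof.
move=> fe lt_de.
rewrite [in LHS](pihomog_partitionE (leqnn (mmeasure mdeg g))) mulr_sumr raddf_sum /=.
rewrite big1 // => i _; apply: pihomog_ne0 (dhomogM fe (pihomogP mdeg i g)).
by apply/eqP; lia.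
Qed.

Lemma adj_hideal J e f : is_hideal J -> f \is e.-homog -> is_hideal (adj J f).
Proof.
move=> [JI JH] fe; split=> [|d x [w Jx]]; first exact: adj_ideal.
have {Jx} := JH d _ Jx; rewrite raddfB /=.
have [lt_de|le_ed] := ltnP d e.
  by rewrite (pihomogM_lt _ fe) // subr0; apply: adj_sub.
by rewrite -(subnKC le_ed) (pihomogM_homog _ _ fe) => Jx; eexists; exact: Jx.
Qed.

Lemma hideal_comp J f : is_hideal J -> (forall d, J (pihomog mdeg d f)) -> J f.
Proof.
move=> [JI _] Jf; rewrite (pihomog_partitionE (leqnn (mmeasure mdeg f))).
by apply: ideal_sum.
Qed.

(** A graded form of Krull's intersection theorem: [f ^+ d.+1 * w] has no component of degree [d],
    so each component of [v] lies in [J]. *)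
Lemma adic_separated J f v : is_hideal J -> homog_pos f ->
  (forall k, exists w, J (v - f ^+ k * w)) -> J v.
Proof.
move=> JI [e e_gt0 fe] Jk; apply: hideal_comp => // d.
have [w Jw] := Jk d.+1; have := JI.2 d _ Jw.
rewrite raddfB /= (pihomogM_lt _ (dhomogMn d.+1 fe)) ?subr0 //.
by rewrite mulnS; nia.
Qed.

Lemma adic_iter J f (T : S -> Prop) v : is_hideal J -> homog_pos f ->
    (forall u, T u -> exists2 w, J (u - f * w) & T w) ->
  T v -> J v.
Proof.
move=> JI hf step Tv; apply: (adic_separated JI hf) => k.
suff [w Jw _] : exists2 w, J (v - f ^+ k * w) & T w by exists w.
elim: k => [|k [w Jw /step [w' Jw' Tw']]].
  by exists v => //; rewrite expr0 mul1r subrr; apply: ideal0 JI.1.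
exists w' => //.
have -> : v - f ^+ k.+1 * w' = (v - f ^+ k * w) + f ^+ k * (w - f * w').
  by rewrite exprS; ring.
by apply: (idealD JI.1) => //; apply: (idealM JI.1).
Qed.

(** Modulo [f], the factor [b + f * w] is [b], a nonzerodivisor by induction. So anything it kills
    is some [f * w'] modulo [J], and [w'] is killed too because [f] cancels; [adic_iter]
    concludes. *)
Lemma nested_nzd fs J b v : is_hideal J -> (forall f, f \in fs -> homog_pos f) ->
  reg J fs -> nested fs b -> J (b * v) -> J v.
Proof.
move=> JI hfs rJ nb; elim: nb J v JI hfs rJ => [|f {}fs k {}b w _ IH] J v JI hfs.
  by rewrite mul1r.
move=> [fJ rJ]; rewrite -mulrA => /(nzd_expr fJ) Jv.
have hf : homog_pos f by apply: hfs; rewrite mem_head.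
apply: (adic_iter (T := fun v => J ((b + f * w) * v)) JI hf _ Jv) => u Ju.
have [|||w' Jw'] := IH (adj J f) u _ _ rJ.
- by have [e _ fe] := hf; apply: adj_hideal fe.
- by move=> g gfs; apply: hfs; rewrite inE gfs orbT.
- exists (- (w * u)).
  by have -> : b * u - f * - (w * u) = (b + f * w) * u by ring.
exists w' => //; apply: fJ.
have -> : f * ((b + f * w) * w') = (b + f * w) * u - (b + f * w) * (u - f * w').
  by ring.
by apply: (idealB JI.1) => //; apply: (idealM JI.1).
Qed.

(** The factor is homogeneous at every layer, so that adding it to a homogeneous ideal gives a
    homogeneous ideal at each stage of an induction. *)
Inductive hnested : seq S -> S -> Prop :=
| hnested_nil : hnested [::] 1
| hnested_cons f fs k b w d : hnested fs b -> b + f * w \is d.-homog ->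
    hnested (f :: fs) (f ^+ k * (b + f * w)).

Lemma hnested_nested fs b : hnested fs b -> nested fs b.
Proof. by elim=> *; constructor. Qed.

(** The degree is chosen from the innermost layer outwards: [f ^+ k] shifts it by [e * k], and a
    component of [f * w] is again a multiple of [f]. *)
Lemma nested_pihomog fs b : (forall f, f \in fs -> homog_pos f) ->
  nested fs b -> exists d, hnested fs (pihomog mdeg d b).
Proof.
move=> hfs nb; elim: nb hfs => [|f {}fs k {}b w _ IH] hfs.
  by exists 0%N; rewrite pihomog_dE ?dhomog1 //; constructor.
have [e e_gt0 fe] : homog_pos f by apply: hfs; rewrite mem_head.
have [|d nb] := IH; first by move=> g gfs; apply: hfs; rewrite inE gfs orbT.
exists (e * k + d)%N; rewrite (pihomogM_homog _ _ (dhomogMn k fe)) raddfD /=.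
have [w' ww'] : exists w', pihomog mdeg d (f * w) = f * w'.
  have [lt_de|le_ed] := ltnP d e.
    by exists 0; rewrite mulr0 (pihomogM_lt _ fe).
  by rewrite -(subnKC le_ed) (pihomogM_homog _ _ fe); eexists.
rewrite ww'; apply: (@hnested_cons f fs k _ w' d) => //.
by rewrite -ww'; apply: rpredD; apply: pihomogP.
Qed.

(** The exchange step for regular sequences: [f * u = g * z] modulo [J] forces [z = f * z'], and
    then [f] cancels. *)
Lemma nzd_adj J f g : is_ideal J -> (forall u, J (f * u) -> J u) ->
    (forall u, adj J f (g * u) -> adj J f u) ->
  forall u, adj J g (f * u) -> adj J g u.
Proof.
move=> JI fJ gJ u [z Jz].
have [|z' Jz'] := gJ z.
  exists u; have -> : g * z - f * u = - (f * u - g * z) by ring.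
  exact: idealN.
exists z'; apply: fJ.
have -> : f * (u - g * z') = (f * u - g * z) + g * (z - f * z') by ring.
by apply: idealD => //; apply: idealM.
Qed.

(* [S / (J + (b))] has depth [size fs - 1], so an element with a smaller
   dimensional annihilator modulo [J + (b)] vanishes there. *)
Lemma small_ann fs k J b c v : is_hideal J -> is_ideal c ->
    (forall f, f \in fs -> homog_pos f) -> reg J fs -> size fs = k.+1 ->
    hnested fs b -> small c k -> (forall s, c s -> adj J b (s * v)) ->
  adj J b v.
Proof.
elim: k => [|k IHk] in fs J b c v * => JI cI hfs rJ szfs nb csm cv.
  have [//|u cu /nested_nilE uE] := csm [::]; move: cu; rewrite {}uE => c1.
  by rewrite -[v]mul1r; apply: cv.
case: nb hfs rJ szfs cv => // f {}fs i {}b w d nb bd hfs [fJ rJ] [szfs] cv.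
have hf : homog_pos f by apply: hfs; rewrite mem_head.
have [e e_gt0 fe] := hf.
have hfs' : forall g, g \in fs -> homog_pos g.
  by move=> g gfs; apply: hfs; rewrite inE gfs orbT.
have JfI : is_hideal (adj J f) by apply: adj_hideal fe.
set b' := b + f * w in bd cv *.
have bJf u : adj J f (b' * u) -> adj J f u.
  move=> [z Jz]; apply: (nested_nzd JfI hfs' rJ (hnested_nested nb)).
  exists (z - w * u).
  by have -> : b * u - f * (z - w * u) = b' * u - f * z by rewrite /b'; ring.
have fJb := nzd_adj JI.1 fJ bJf.
have bJ u : J (b' * u) -> J u.
  apply: (nested_nzd (fs := f :: fs) (b := b')) => //.
  by have := nested_cons f 0 w (hnested_nested nb); rewrite expr0 mul1r.
have JbI : is_hideal (adj J b') by apply: adj_hideal bd.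
have cJb s : c s -> adj J b' (s * v).
  move=> /cv [z Jz]; exists (f ^+ i * z).
  by have -> : s * v - b' * (f ^+ i * z) = s * v - f ^+ i * b' * z by ring.
(* First leave out the power of [f]. Passing to the saturation makes [f] a nonzerodivisor modulo
   [c'], and [c'] still annihilates [v] because [f] is a nonzerodivisor modulo [J + (b')]. *)
have [s0 Js0] : adj J b' v.
  pose c' := saturation c f.
  have c'I : is_ideal c' by apply: saturation_ideal.
  have c'J s : c' s -> adj J b' (s * v).
    by move=> [l /cJb]; rewrite -mulrA; apply: nzd_expr fJb _.
  apply: (adic_iter (T := fun u => forall s, c' s -> adj J b' (s * u)) JbI hf _ c'J).
  move=> u c'u.
  (* Induction modulo [f], where [b'] becomes [b]: it puts [u] in [J + (f, b)], which is
     [J + (f, b')]. *)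
  have [|||] := IHk fs (adj J f) b (adj c' f) u JfI _ hfs' rJ szfs nb.
  - exact: adj_ideal.
  - apply: small_adj => //; first by move=> g; apply: saturation_nzd.
    move=> gs /csm [x cx nx]; exists x => //; exists 0%N.
    by rewrite expr0 mul1r.
  - move=> s [t c't]; have [z Jz] := c'u _ c't.
    exists z, (t * u + w * z).
    have -> : s * u - b * z - f * (t * u + w * z) = (s - f * t) * u - b' * z.
      by rewrite /b'; ring.
    exact: Jz.
  move=> z [t Jt]; have Ju : adj J b' (u - f * (t - w * z)).
    exists z.
    by have -> : u - f * (t - w * z) - b' * z = u - b * z - f * t
      by rewrite /b'; ring.
  exists (t - w * z) => // s c's; apply: fJb.
  have -> : f * (s * (t - w * z)) = s * u - s * (u - f * (t - w * z)) by ring.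
  by apply: (idealB JbI.1); [apply: c'u | apply: (idealM JbI.1)].
have cJ s : c s -> adj J (f ^+ i) (s * s0).
  move=> cs; have [z Jz] := cv s cs; exists z; apply: bJ.
  have -> : b' * (s * s0 - f ^+ i * z) =
      (s * v - f ^+ i * b' * z) - s * (v - b' * s0) by ring.
  by apply: (idealB JI.1) => //; apply: (idealM JI.1).
(* It remains to divide [s0] by [f ^+ i]. An element of [c] nested in [fs] is a nonzerodivisor
   modulo [J + (f)], so each of the [i] factors can be split off in turn. *)
have [t Jt] : adj J (f ^+ i) s0.
  elim: i s0 cJ {Js0 cv} => [|i IHi] s0 cJ.
    by exists s0; rewrite expr0 mul1r subrr; apply: ideal0 JI.1.
  have [x cx nx] := csm fs szfs.
  have [s1 Js1] : adj J f s0.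
    apply: (nested_nzd JfI hfs' rJ nx); have [z Jz] := cJ x cx.
    by exists (f ^+ i * z); rewrite mulrA -exprS.
  have [|z Jz] := IHi s1.
    move=> s cs.
    have [z Jz] := cJ s cs; exists z; apply: fJ.
    have -> : f * (s * s1 - f ^+ i * z) =
        (s * s0 - f ^+ i.+1 * z) - s * (s0 - f * s1) by rewrite exprS; ring.
    by apply: (idealB JI.1) => //; apply: (idealM JI.1).
  exists z; have -> : s0 - f ^+ i.+1 * z = (s0 - f * s1) + f * (s1 - f ^+ i * z).
    by rewrite exprS; ring.
  by apply: (idealD JI.1) => //; apply: (idealM JI.1).
exists t; have -> : v - f ^+ i * b' * t = (v - b' * s0) + b' * (s0 - f ^+ i * t).
  by ring.
by apply: (idealD JI.1) => //; apply: (idealM JI.1).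
Qed.

End Graded.

(** * Monomial ideals described by their exponents *)

Section MonomialIdeals.
Local Open Scope ring_scope.
Variables (K : fieldType) (n : nat).
Local Notation S := {mpoly K[n]}.
Implicit Types (U : 'X_{1..n} -> Prop) (f g : S).

(** When [U] is stable under adding exponents, this is a monomial ideal; other [U] describe parts of
    a polynomial. *)
Definition supported U f : Prop := forall m, m \in msupp f -> U m.

Lemma supported0 U : supported U 0.
Proof. by move=> m; rewrite msupp0. Qed.

Lemma supportedD U f g : supported U f -> supported U g -> supported U (f + g).
Proof.
by move=> Uf Ug m /msuppD_le; rewrite mem_cat => /orP[/Uf|/Ug].
Qed.

Lemma supportedZ U c f : supported U f -> supported U (c *: f).
Proof. by move=> Uf m /msuppZ_le /Uf. Qed.

Lemma supportedX U m : U m -> supported U 'X_[m].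
Proof. by move=> Um m'; rewrite msuppX inE => /eqP ->. Qed.

Lemma supportedM U1 U2 U f g :
    (forall m1 m2, U1 m1 -> U2 m2 -> U (m1 + m2)%MM) ->
  supported U1 f -> supported U2 g -> supported U (f * g).
Proof.
move=> U12 U1f U2g m /msuppM_le /allpairsP [[m1 m2] /= [m1f m2g ->]].
by apply: U12; [apply: U1f | apply: U2g].
Qed.

Lemma supported_coef U f m : supported U f -> ~ U m -> f@_m = 0.
Proof.
by move=> Uf nUm; apply/eqP; rewrite mcoeff_eq0; apply/negP => /Uf.
Qed.

Lemma supported_sum U (T : eqType) (r : seq T) (P : pred T) (F : T -> S) :
  (forall i, i \in r -> P i -> supported U (F i)) ->
  supported U (\sum_(i <- r | P i) F i).
Proof.
move=> UF; rewrite big_seq_cond; elim/big_ind: _ => [|f g Uf Ug|i /andP[ir Pi]].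
- exact: supported0.
- exact: supportedD Uf Ug.
- exact: UF ir Pi.
Qed.

Lemma supported_split U f :
  exists f1 f2, [/\ f = f1 + f2, supported U f1 & supported (fun m => ~ U m) f2].
Proof.
exists (\sum_(m <- msupp f | `[< U m >]) f@_m *: 'X_[m]),
  (\sum_(m <- msupp f | ~~ `[< U m >]) f@_m *: 'X_[m]); split.
- by rewrite {1}[f]mpolyE (bigID (fun m => `[< U m >])).
- by apply: supported_sum => m _ /asboolP Um; apply: supportedZ; apply: supportedX.
- by apply: supported_sum => m _ /asboolPn Um; apply: supportedZ; apply: supportedX.
Qed.

Lemma supported_hideal U :
  (forall m m', U m -> U (m' + m)%MM) -> is_hideal (supported U).
Proof.
move=> Uup; split; last first.
  move=> d f Uf; apply: supported_sum => m mf _.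
  by apply: supportedZ; apply: supportedX; apply: Uf.
split; [exact: supported0 | by move=> *; apply: supportedD |].
move=> a x Ux; apply: (supportedM (U1 := fun _ => True)) Ux => // m1 m2 _.
exact: Uup.
Qed.

End MonomialIdeals.

(** * Polynomial expressions in given elements with bounded exponents *)

Section Boxes.
Local Open Scope ring_scope.

Fixpoint box (N r : nat) : seq (seq nat) :=
  if r is r'.+1 then [seq a :: s | a <- iota 0 N, s <- box N r'] else [:: [::]].

Lemma size_box N r : size (box N r) = (N ^ r)%N.
Proof. by elim: r => //= r IH; rewrite size_allpairs IH size_iota expnS. Qed.

Lemma mem_box N r s : (s \in box N r) = (size s == r) && all (fun a => a < N)%N s.
Proof.
elim: r s => [|r IH] [|a s] //=.
  by apply/allpairsP => -[[b t] /= [_ _]].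
rewrite eqSS; apply/allpairsP/idP => [[[b t] /= []]|].
  by rewrite mem_iota add0n IH => /= ltb /andP[sz lt] [-> ->]; rewrite sz ltb.
case/and3P=> sz lta lt; exists (a, s).
by rewrite mem_iota IH sz lta lt.
Qed.

Lemma box_uniq N r : uniq (box N r).
Proof.
elim: r => //= r IH; apply: allpairs_uniq => //; first exact: iota_uniq.
by move=> [a s] [b t] _ _ /= [-> ->].
Qed.

Variables (K : fieldType) (n : nat).
Local Notation S := {mpoly K[n]}.
Implicit Types (gs : seq S) (s : seq nat).

Fixpoint monval gs s : S :=
  match gs, s with
  | g :: gs', a :: s' => g ^+ a * monval gs' s'
  | _, _ => 1
  end.

Definition boxval N gs (c : seq nat -> K) : S :=
  \sum_(s <- box N (size gs)) c s *: monval gs s.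

(** Group the sum by powers of [g]. The lowest power [i] with a nonzero coefficient is factored out,
    that coefficient is nested in [gs] by induction up to the scalar [k], and the higher powers are
    multiples of [g]. *)
Lemma nested_boxval N gs c :
    (exists2 s, s \in box N (size gs) & c s != 0) ->
  exists2 k, k != 0 & nested gs (k *: boxval N gs c).
Proof.
elim: gs c => [|g gs IH] c [s].
  rewrite inE => /eqP -> c0; exists (c [::])^-1; first by rewrite invr_eq0.
  rewrite /boxval /= big_seq1 scalerA mulVf // scale1r; exact: nested_nil.
case: s => [|a s]; first by rewrite mem_box.
rewrite mem_box /= eqSS => /and3P[szs ltaN sN] cas.
pose P a := has (fun s => c (a :: s) != 0) (box N (size gs)).
have exP : exists a, P a.
  by exists a; apply/hasP; exists s => //; rewrite mem_box szs.
case: (ex_minnP exP) => i /hasP [t tb ct] i_min.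
have ltiN : (i < N)%N.
  apply: leq_ltn_trans ltaN; apply: i_min; apply/hasP; exists s => //.
  by rewrite mem_box szs.
pose F a := boxval N gs (fun s => c (a :: s)).
have bE : boxval N (g :: gs) c = \sum_(0 <= j < N) g ^+ j * F j.
  rewrite /boxval /= big_allpairs_dep /index_iota subn0; apply: eq_bigr => j _.
  by rewrite mulr_sumr; apply: eq_bigr => u _; rewrite scalerAr.
have [k k0 nk] := IH (fun s => c (i :: s)) (ex_intro2 _ _ t tb ct).
exists k => //.
have -> : k *: boxval N (g :: gs) c =
    g ^+ i * (k *: F i + g * \sum_(i.+1 <= j < N) k *: (g ^+ (j - i.+1) * F j)).
  rewrite bE (big_cat_nat (n := i)) //=; last exact: ltnW.
  rewrite big_nat big1 ?add0r => [|j /andP[_ ltji]]; last first.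
    rewrite /F /boxval big_seq big1 ?mulr0 // => u ub.
    have [->|cu] := eqVneq (c (j :: u)) 0; first by rewrite scale0r.
    have : P j by apply/hasP; exists u.
    by move/i_min; rewrite leqNgt ltji.
  rewrite big_ltn // scalerDr mulrDr scalerAr; congr (_ + _).
  rewrite scaler_sumr mulrA -exprSr mulr_sumr; apply: eq_big_nat => j /andP[ltij _].
  by rewrite -!scalerAr mulrA -exprD subnKC.
exact: nested_cons.
Qed.

Lemma msizeM_leq (f g : S) : (msize (f * g) <= msize f + msize g)%N.
Proof.
have [->|f0] := eqVneq f 0; first by rewrite mul0r msize0.
have [->|g0] := eqVneq g 0; first by rewrite mulr0 msize0.
by rewrite msizeM // leq_pred.
Qed.

Lemma msize_expr (f : S) a : (msize (f ^+ a) <= (a * msize f).+1)%N.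
Proof.
elim: a => [|a IH]; first by rewrite expr0 msize1.
by rewrite exprS; apply: leq_trans (msizeM_leq _ _) _; rewrite mulSn; lia.
Qed.

Lemma msize_monval N gs s : all (fun a => a < N)%N s ->
  (msize (monval gs s) <= (N * \sum_(g <- gs) (msize g).+1).+1)%N.
Proof.
elim: gs s => [|g gs IH] s; first by rewrite big_nil muln0 msize1.
case: s => [|a s] /=; first by rewrite msize1.
case/andP=> lta /IH szs; rewrite big_cons.
apply: leq_trans (msizeM_leq _ _) _.
have := msize_expr g a; nia.
Qed.

End Boxes.

(** * Coordinate primes and the count of monomials *)

Section CoordinateIdeals.
Local Open Scope ring_scope.
Variables (K : fieldType) (V : finType).
Local Notation S := {mpoly K[#|V|]}.
Implicit Types (A : {set V}) (m : 'X_{1..#|V|}).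

Definition mexp m (v : V) : nat := m (enum_rank v).

Lemma mexpD m1 m2 v : mexp (m1 + m2)%MM v = (mexp m1 v + mexp m2 v)%N.
Proof. exact: mnmDE. Qed.

Lemma mexp1 u v : mexp U_(enum_rank u)%MM v = (u == v).
Proof. by rewrite /mexp mnm1E (inj_eq enum_rank_inj). Qed.

Lemma mexp_mdeg m v : (mexp m v <= mdeg m)%N.
Proof. by rewrite mdegE (bigD1 (enum_rank v)) //= leq_addr. Qed.

Definition leaves A m : Prop := exists2 v, v \notin A & (0 < mexp m v)%N.

(** The prime generated by the variables outside [A]; its quotient is the polynomial ring on [A]. *)
Definition coord_ideal A : S -> Prop := supported (leaves A).

Lemma coord_hideal A : is_hideal (coord_ideal A).
Proof.
apply: supported_hideal => m m' [v vA mv]; exists v => //.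
by rewrite mexpD; lia.
Qed.

Lemma leaves0 A : ~ leaves A 0%MM.
Proof. by case=> v _; rewrite /mexp mnm0E. Qed.

Lemma leavesD A m1 m2 : leaves A (m1 + m2)%MM -> leaves A m1 \/ leaves A m2.
Proof.
case=> v vA; rewrite mexpD addn_gt0 => /orP[mv|mv]; [left|right]; by exists v.
Qed.

Lemma coord_ideal1 A : ~ coord_ideal A 1.
Proof. by move=> q1; apply: (@leaves0 A); apply: q1; rewrite msupp1 inE. Qed.

Lemma coord_var A v : v \notin A -> coord_ideal A (vertex_var K v).
Proof. by move=> vA; apply: supportedX; exists v => //; rewrite mexp1 eqxx. Qed.

Lemma coord_var_in A v : v \in A -> ~ coord_ideal A (vertex_var K v).
Proof.
move=> vA q; have [|u uA] := q U_(enum_rank v)%MM; first by rewrite msuppX inE.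
by rewrite mexp1; case: eqP uA => // <-; rewrite vA.
Qed.

(** The parts of [f] and [g] free of the variables outside [A] have a product that is both free of
    them and in the ideal, hence zero in a domain. *)
Lemma coord_prime A (f g : S) : coord_ideal A (f * g) -> coord_ideal A f \/ coord_ideal A g.
Proof.
have [qI _] := coord_hideal A => qfg.
have [f1 [f2 [fE qf1 nf2]]] := supported_split (leaves A) f.
have [g1 [g2 [gE qg1 ng2]]] := supported_split (leaves A) g.
have q22 : coord_ideal A (f2 * g2).
  have -> : f2 * g2 = f * g - (g * f1 + f2 * g1) by rewrite fE gE; ring.
  by apply: (idealB qI) => //; apply: (idealD qI); apply: (idealM qI).
have /eqP : f2 * g2 = 0.
  apply: msuppnil0; case E : (msupp _) => [//|m s].
  have ms : m \in msupp (f2 * g2) by rewrite E mem_head.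
  have n22 : supported (fun m => ~ leaves A m) (f2 * g2).
    by apply: (supportedM _ nf2 ng2) => m1 m2 n1 n2 /leavesD [].
  by case: (n22 m ms (q22 m ms)).
rewrite mulf_eq0 => /orP[]/eqP E; [left; rewrite fE | right; rewrite gE];
  by rewrite E addr0.
Qed.

(** There are [N ^ k] power products of [gs] with exponents below [N], but modulo the ideal they
    involve only [B ^ q] monomials in the variables of [A]. For large [N] a nontrivial combination
    therefore lies in the ideal. *)
Lemma coord_small A k : (#|A| < k)%N -> small (coord_ideal A) k.
Proof.
move=> ltAk gs szgs.
(* [B] exceeds every degree that occurs. As [B <= N * E.+1] and [N] is one more than [E.+1 ^ q], one
   gets [B ^ q < N ^ q.+1 <= N ^ k]. *)
pose E := (\sum_(g <- gs) (msize g).+1)%N; pose q := #|A|.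
pose N := ((E.+1 ^ q).+1)%N; pose B := (N * E).+1.
have ltBN : (B ^ q < N ^ k)%N.
  apply: leq_ltn_trans (_ : (N ^ q * E.+1 ^ q < _)%N).
    rewrite -expnMn; have : (B <= N * E.+1)%N by rewrite /B mulnS /N addSn ltnS leq_addl.
    by case: (q) => // q' leB; rewrite leq_exp2r.
  apply: (@leq_trans (N ^ q.+1)%N); last by rewrite leq_pexp2l.
  by rewrite expnSr ltn_pmul2l // expn_gt0.
pose mA (t : seq nat) : 'X_{1..#|V|} :=
  [multinom nth 0%N t (index (enum_val i) (enum A)) | i < #|V|].
pose M : 'M[K]_(N ^ k, B ^ q) :=
  \matrix_(i, j) (monval gs (nth [::] (box N k) i))@_(mA (nth [::] (box B q) j)).
have /rowV0Pn [u uM u0] : kermx M != 0.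
  rewrite -mxrank_eq0 mxrank_ker subn_eq0 -ltnNge.
  exact: leq_ltn_trans (rank_leq_col M) ltBN.
move/sub_kermxP: uM => uM.
pose c s : K := if insub (index s (box N k)) is Some i then u 0 i else 0.
have cE (i : 'I_(N ^ k)) : c (nth [::] (box N k) i) = u 0 i.
  by rewrite /c index_uniq ?size_box ?box_uniq // valK.
have [|a a0 na] := nested_boxval (N := N) (gs := gs) (c := c).
  have [i ui] : exists i, u 0 i != 0.
    apply/existsP; apply: contraNT u0; rewrite negb_exists => /forallP u0.
    apply/eqP/rowP => i; rewrite mxE; apply/eqP.
    by have := u0 i; rewrite negbK.
  exists (nth [::] (box N k) i); last by rewrite cE.
  by rewrite szgs mem_nth // size_box.
exists (a *: boxval N gs c) => //; apply: supportedZ => m ms.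
(* A monomial of the combination involving only variables of [A] would index a column of [M], and
   its coefficient is then an entry of [u *m M], which is zero. *)
apply: contrapT => nl.
have mB v : (mexp m v < B)%N.
  suff: (mdeg m < B)%N by apply: leq_ltn_trans; apply: mexp_mdeg.
  have /(_ m ms) : supported (fun m => (mdeg m < B)%N) (boxval N gs c); last by [].
  apply: supported_sum => s; rewrite mem_box => /andP[_ sN] _.
  apply: supportedZ => m' /msize_mdeg_lt; move/leq_trans; apply.
  exact: msize_monval.
have mE : m = mA [seq mexp m v | v <- enum A].
  apply/mnmP => i; rewrite mnmE.
  have [iA|iA] := boolP (enum_val i \in A).
    rewrite (nth_map (enum_val i)) ?index_mem ?mem_enum //.
    by rewrite nth_index ?mem_enum // /mexp enum_valK.
  rewrite nth_default ?size_map; last by rewrite memNindex ?mem_enum.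
  apply/eqP; apply: contra_notT nl => mi; exists (enum_val i) => //.
  by rewrite /mexp enum_valK lt0n.
have tB : [seq mexp m v | v <- enum A] \in box B q.
  rewrite mem_box size_map -cardE eqxx /=; apply/allP => x /mapP [v _ ->].
  exact: mB.
move: ms; rewrite mcoeff_msupp; case/eqP.
have ltj : (index [seq mexp m v | v <- enum A] (box B q) < B ^ q)%N.
  by rewrite -(size_box B q) index_mem.
have /matrixP /(_ 0 (Ordinal ltj)) := uM; rewrite !mxE => <-.
rewrite /boxval raddf_sum szgs /= (big_nth [::]) size_box big_mkord.
apply: eq_bigr => i _; rewrite mcoeffZ cE mxE /=.
by rewrite nth_index // -mE.
Qed.

End CoordinateIdeals.

(** * Transfer of regular sequences from a quotient to the polynomial ring *)

Section Quotients.
Local Open Scope ring_scope.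
Local Open Scope quotient_scope.

Lemma idealr_is_ideal (R : comNzRingType) (I : idealr R) :
  is_ideal (fun x => x \in I).
Proof.
by split=> [|x y xI yI|a x xI]; rewrite ?idealr0 ?rpredD ?idealMr.
Qed.

Lemma ideal_gen_is_ideal (R : comNzRingType) (A : {pred R}) :
  is_ideal (fun x => x \in ideal_gen A).
Proof.
split=> [|x y xA yA|a x xA]; first exact: ideal_gen0.
  by rewrite -[x]mul1r ideal_gen_lin.
by rewrite -[a * x]addr0 ideal_gen_lin ?ideal_gen0.
Qed.

Lemma mem_ideal_gen (R : comNzRingType) (A : {pred R}) x :
  x \in A -> x \in ideal_gen A.
Proof.
move=> xA; apply/asboolP; exists [:: (1, x)].
by rewrite big_seq1 mul1r; split=> // y; rewrite inE => /eqP ->.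
Qed.

Lemma ideal_gen_min (R : comNzRingType) (A : {pred R}) (J : R -> Prop) x :
  is_ideal J -> (forall a, a \in A -> J a) -> x \in ideal_gen A -> J x.
Proof.
move=> JI AJ /asboolP [c [cA ->]]; apply: (ideal_sum JI) => p pc.
by apply: (idealM JI); apply: AJ; apply: cA; apply: map_f.
Qed.

Lemma ideal_gen_rcons (R : comNzRingType) (l : seq R) f x :
  x \in ideal_gen (mem (rcons l f)) <->
  adj (fun x => x \in ideal_gen (mem l)) f x.
Proof.
split=> [|[w xw]].
  have JI : is_ideal (adj (fun x => x \in ideal_gen (mem l)) f).
    exact/adj_ideal/ideal_gen_is_ideal.
  apply: (ideal_gen_min JI) => a.
  rewrite mem_rcons inE => /orP[/eqP ->|al].
    by rewrite -[X in adj _ _ X]mulr1; apply/adj_gen/ideal_gen_is_ideal.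
  by apply: adj_sub; apply: mem_ideal_gen.
have I1 := ideal_gen_is_ideal (mem (rcons l f)).
rewrite -[x](subrK (f * w)); apply: (idealD I1).
  apply: (ideal_gen_min I1) xw => a al; apply: mem_ideal_gen.
  by rewrite mem_rcons inE al orbT.
rewrite mulrC; apply: (idealM I1); apply: mem_ideal_gen.
by rewrite mem_rcons mem_head.
Qed.

Definition adjs (R : comNzRingType) (J : R -> Prop) l := foldl (@adj R) J l.

Lemma adjs_ideal (R : comNzRingType) (J : R -> Prop) l :
  is_ideal J -> is_ideal (adjs J l).
Proof. by elim: l J => //= f l IH J JI; apply: IH; apply: adj_ideal. Qed.

Lemma adjs_sub (R : comNzRingType) (J : R -> Prop) l f : J f -> adjs J l f.
Proof. by elim: l J => //= g l IH J Jf; apply: IH; apply: adj_sub. Qed.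

Lemma adjs_gen (R : comNzRingType) (J : R -> Prop) l f :
  is_ideal J -> f \in l -> adjs J l f.
Proof.
elim: l J => //= g l IH J JI; rewrite inE => /orP[/eqP ->|fl].
  by apply: adjs_sub; have := adj_gen g 1 JI; rewrite mulr1.
by apply: IH => //; apply: adj_ideal.
Qed.

Lemma adjs_min (R : comNzRingType) (J J' : R -> Prop) l :
    is_ideal J' -> (forall f, J f -> J' f) -> (forall f, f \in l -> J' f) ->
  forall f, adjs J l f -> J' f.
Proof.
move=> J'I; elim: l J => //= g l IH J JJ' lJ'; apply: IH => [f [w /JJ' J'f]|f fl].
  rewrite -[f](subrK (g * w)) mulrC; apply: (idealD J'I).
    by rewrite mulrC.
  by apply: (idealM J'I); apply: lJ'; rewrite mem_head.
by apply: lJ'; rewrite inE fl orbT.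
Qed.

Lemma reg_adjs (R : comNzRingType) (J : R -> Prop) l :
  reg J l <-> (forall k, (k < size l)%N ->
    forall g, adjs J (take k l) (l`_k * g) -> adjs J (take k l) g).
Proof.
elim: l J => [|f l IH] J /=; first by split.
split=> [[fJ /IH rJ] [|k] ltk g|H] //=; first exact: fJ.
  exact: rJ.
by split; [apply: (H 0%N) | apply/IH => k ltk; apply: (H k.+1)].
Qed.

Variables (K : fieldType) (n : nat) (I : idealr {mpoly K[n]}).
Local Notation S := {mpoly K[n]}.
Local Notation Q := {ideal_quot I}.
Local Notation piQ f := (\pi_Q f : Q).
Local Notation memI := (fun x : S => x \in I).

Lemma piD x y : piQ (x + y) = piQ x + piQ y. Proof. exact: raddfD. Qed.
Lemma piB x y : piQ (x - y) = piQ x - piQ y. Proof. exact: raddfB. Qed.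
Lemma piM x y : piQ (x * y) = piQ x * piQ y. Proof. exact: rmorphM. Qed.
Lemma pi0 : piQ 0 = 0. Proof. exact: raddf0. Qed.
Lemma pi1 : piQ 1 = 1. Proof. exact: rmorph1. Qed.

Lemma pi_eq0 (x : S) : (piQ x == 0) = (x \in I).
Proof. by rewrite -pi0 -Quotient.idealrBE subr0. Qed.

Lemma pi_ideal_gen l (x : S) :
  piQ x \in ideal_gen (mem [seq piQ f | f <- l]) <-> adjs memI l x.
Proof.
elim/last_ind: l x => [|l f IH] x.
  split=> [xI|xI].
    have ZI : is_ideal (fun y : Q => y = 0).
      by split=> [//|y z -> ->|a y ->]; rewrite ?addr0 ?mulr0.
    have : piQ x = 0 by apply: (ideal_gen_min ZI) xI.
    by move/eqP; rewrite pi_eq0.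
  have -> : piQ x = 0; last exact: ideal_gen0.
  by apply/eqP; rewrite pi_eq0.
rewrite map_rcons /adjs foldl_rcons; split=> [/ideal_gen_rcons|] [w xw].
  exists (repr w); apply/IH.
  by rewrite piB piM reprK.
apply/ideal_gen_rcons; exists (piQ w); move/IH: xw.
by rewrite piB piM.
Qed.

(** By [pi_ideal_gen], the ideals generated in the quotient correspond to ideals of the polynomial
    ring obtained by adding generators to [I]. *)
Lemma homog_regular_seqE s : homog_regular_seq I s <->
  [/\ forall f, f \in s -> homog_pos f, reg memI s & ~ adjs memI s 1].
Proof.
have nthE k : (k < size s)%N -> [seq piQ f | f <- s]`_k = piQ s`_k.
  by move=> ltk; rewrite (nth_map 0).
have -> : homog_regular_seq I s <->
  (forall f, f \in s -> homog_pos f) /\ reg memI s /\ ~ adjs memI s 1; last first.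
  by split=> [[? []]|[]].
rewrite /homog_regular_seq /regular_seq size_map.
have E1 : (1 \notin ideal_gen (mem [seq piQ f | f <- s])) <-> ~ adjs memI s 1.
  rewrite -pi1; split=> [/negP n1 /pi_ideal_gen //|n1].
  by apply/negP => /pi_ideal_gen.
suff E2 : (forall k, (k < size s)%N -> forall g : Q,
    [seq piQ f | f <- s]`_k * g \in ideal_gen (mem (take k [seq piQ f | f <- s])) ->
    g \in ideal_gen (mem (take k [seq piQ f | f <- s]))) <-> reg memI s.
  by split=> [[H [/E2 ? /E1 ?]]|[H [/E2 ? /E1 ?]]].
split=> [H|/reg_adjs H].
  apply/reg_adjs => k ltk g Hg; apply/pi_ideal_gen; rewrite map_take.
  by apply: H => //; rewrite nthE // -piM -map_take; apply/pi_ideal_gen.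
move=> k ltk g; rewrite -[g]reprK nthE // -piM -map_take => /pi_ideal_gen Hg.
by apply/pi_ideal_gen; apply: H.
Qed.

End Quotients.

(** * The edge ideal and the dimension of the edge ring *)

Section EdgeIdeal.
Local Open Scope ring_scope.
Local Open Scope quotient_scope.
Variables (K : fieldType) (V : finType) (e : rel V).
Local Notation S := {mpoly K[#|V|]}.
Implicit Types (A : {set V}) (m : 'X_{1..#|V|}).

Definition has_edge m : Prop :=
  exists u v, [/\ e u v, (0 < mexp m u)%N & (0 < mexp m v)%N].

Lemma has_edgeD m m' : has_edge m -> has_edge (m' + m)%MM.
Proof.
by case=> u [v [euv mu mv]]; exists u, v; split=> //; rewrite mexpD; lia.
Qed.

Local Notation edgeI := (@edge_ideal V e K).
Hypothesis e_irr : irreflexive e.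

(** As [e] is irreflexive, a monomial involving both ends of an edge involves two distinct variables
    and is divisible by their product. *)
Lemma edge_idealE x : x \in edgeI <-> supported has_edge x.
Proof.
have HI := supported_hideal K has_edgeD.
split=> [|xs].
  apply: (ideal_gen_min HI.1) => a /existsP [u /existsP [v /andP [euv /eqP ->]]].
  rewrite /vertex_var -mpolyXD; apply: supportedX; exists u, v.
  by rewrite !mexpD !mexp1 !eqxx; split=> //; rewrite addn1.
have EI := ideal_gen_is_ideal (@edge_monomials V e K).
rewrite [x]mpolyE; apply: (ideal_sum EI) => m /xs [u [v [euv mu mv]]].
rewrite -mul_mpolyC; apply: (idealM EI).
have -> : m = (m - (U_(enum_rank u) + U_(enum_rank v)) +
               (U_(enum_rank u) + U_(enum_rank v)))%MM.
  rewrite submK //; apply/mnm_lepP => i; rewrite mnmDE !mnm1E.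
  have [iu|iu] := eqVneq (enum_rank u) i; have [iv|iv] := eqVneq (enum_rank v) i => //.
  - have := euv; have -> : u = v by apply: enum_rank_inj; rewrite iu iv.
    by rewrite e_irr.
  - by rewrite -iu addn0.
  - by rewrite -iv.
rewrite mpolyXD; apply: (idealM EI); apply: mem_ideal_gen.
apply/existsP; exists u; apply/existsP; exists v.
by rewrite euv /vertex_var mpolyXD eqxx.
Qed.

Local Notation I := (fun x => x \in edgeI).

Lemma edge_hideal : is_hideal I.
Proof.
have [HI HH] := supported_hideal K has_edgeD.
split; first exact: idealr_is_ideal.
by move=> d f /edge_idealE fI; apply/edge_idealE; apply: HH.
Qed.

Lemma edge_var u v : e u v -> vertex_var K u * vertex_var K v \in edgeI.
Proof.
move=> euv; apply: mem_ideal_gen.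
by apply/existsP; exists u; apply/existsP; exists v; rewrite euv eqxx.
Qed.

Definition indep A : Prop := forall u v, u \in A -> v \in A -> ~~ e u v.

Lemma edge_sub_coord A x : indep A -> x \in edgeI -> coord_ideal A x.
Proof.
move=> Ai /edge_idealE xI m /xI [u [v [euv mu mv]]].
have [uA|uA] := boolP (u \in A); last by exists u.
have [vA|vA] := boolP (v \in A); last by exists v.
by have := Ai u v uA vA; rewrite euv.
Qed.

Local Notation Q := {ideal_quot (edgeI : idealr S)}.

(** Removing the vertices of [A] one at a time leaves independent sets, whose coordinate primes
    contain the edge ideal and increase strictly. *)
Lemma krull_lower A : indep A ->
  exists P : 'I_#|A|.+1 -> prime_idealr Q, prime_chain P.
Proof.
(* Membership is tested on a representative; by [pE] the choice does not matter for independent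
   [B]. *)
move=> Ai; pose p B : {pred Q} := [pred x | `[< coord_ideal B (repr x) >]].
have pE B (x : S) : indep B -> (\pi_Q x \in p B) = `[< coord_ideal B x >].
  move=> Bi; rewrite inE; apply: asbool_equiv_eq.
  have [BI _] := coord_hideal K B.
  have qx : coord_ideal B (repr (\pi_Q x : Q) - x).
    apply: (edge_sub_coord Bi).
    by rewrite Quotient.idealrBE reprK.
  split=> qB; first by rewrite -[x](subKr (repr (\pi_Q x : Q))); apply: (idealB BI).
  by rewrite -[repr _](subrK x); apply: (idealD BI).
have pI B : indep B -> idealr_closed (p B).
  move=> Bi; have [BI _] := coord_hideal K B; split.
  - by rewrite -pi0 pE //; apply/asboolP; exact: ideal0 BI.
  - by rewrite -pi1 pE //; apply/asboolP/coord_ideal1.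
  move=> a u v; rewrite -[a]reprK -[u]reprK -[v]reprK.
  rewrite -piM -piD !pE // => /asboolP uB /asboolP vB; apply/asboolP.
  by apply: (idealD BI) => //; apply: (idealM BI).
have pP B : indep B -> prime_idealr_closed (p B).
  move=> Bi u v; rewrite -[u]reprK -[v]reprK -piM !pE // => /asboolP.
  by move=> /coord_prime [?|?]; apply/orP; [left|right]; apply/asboolP.
pose B (i : nat) : {set V} := [set v in drop i (enum A)].
have Bi i : indep (B i).
  by move=> u v; rewrite !inE => /mem_drop uA /mem_drop vA; apply: Ai;
    rewrite -mem_enum.
pose P (i : 'I_#|A|.+1) : prime_idealr Q :=
  HB.pack_for (prime_idealr Q) (p (B i)) (isIdealr.Build Q _ (pI _ (Bi i)))
    (isPrimeIdealrClosed.Build Q _ (pP _ (Bi i))).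
exists P => i j ltij.
have PE k (x : S) : (\pi_Q x \in P k) = `[< coord_ideal (B k) x >] by apply: pE.
have ltiA : (i < size (enum A))%N by rewrite -cardE; have := ltn_ord j; lia.
split=> [x|].
  rewrite -[x]reprK !PE => /asboolP qi; apply/asboolP => m /qi [v vB mv].
  exists v => //; apply: contra vB; rewrite !inE.
  by rewrite -(subnK (ltnW ltij)) -drop_drop; apply: mem_drop.
have [v0 _] : {v0 : V | v0 \in enum A} by case: (enum A) ltiA => // a s _;
  exists a; rewrite mem_head.
exists (\pi_Q (vertex_var K (nth v0 (enum A) i))).
  rewrite PE; apply/asboolP/coord_var; rewrite inE.
  apply/negP => /(nthP v0) [k ltk]; rewrite nth_drop => /eqP.
  rewrite size_drop in ltk.
  by rewrite nth_uniq ?enum_uniq //; lia.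
rewrite PE; apply/asboolP/coord_var_in.
by rewrite inE (drop_nth v0) // mem_head.
Qed.

(** [A] collects the variables outside the smallest prime, which contains every edge monomial, so
    [A] is independent. That prime contains [coord_ideal A]; if [d] exceeded [#|A|], it would
    contain an element nested in witnesses of the strict inclusions, and [nested_chain] would put 1
    in the largest prime. *)
Lemma krull_upper d (P : 'I_d.+1 -> prime_idealr Q) : prime_chain P ->
  exists2 A, indep A & (d <= #|A|)%N.
Proof.
move=> Pch; pose J (i : nat) (x : S) : Prop := \pi_Q x \in P (inord i).
have JI i : is_ideal (J i).
  split; rewrite /J.
  - by rewrite pi0 idealr0.
  - by move=> x y xJ yJ; rewrite piD rpredD.
  - by move=> a x xJ; rewrite piM idealMr.
have Jprime i x y : J i (x * y) -> J i x \/ J i y.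
  by rewrite /J piM prime_idealrM => /orP.
have J1 i : ~ J i 1 by rewrite /J pi1 idealr1.
have edgeJ x : x \in edgeI -> J 0%N x.
  move=> xI; rewrite /J; have -> : \pi_Q x = 0; last exact: idealr0.
  by apply/eqP; rewrite pi_eq0.
pose A := [set v | ~~ `[< J 0%N (vertex_var K v) >]].
exists A.
  move=> u v; rewrite !inE => /asboolPn nu /asboolPn nv; apply/negP => euv.
  by have [] := Jprime _ _ _ (edgeJ _ (edge_var euv)).
rewrite leqNgt; apply/negP => ltAd.
have sub0 i x : (i < d)%N -> J i x -> J i.+1 x.
  move=> ltid; have [|sP _] := Pch (inord i) (inord i.+1); last exact: sP.
  by rewrite !inordK; lia.
have gP i : exists y, (i < d)%N -> J i.+1 y /\ ~ J i y.
  have [ltid|] := ltnP i d; last by exists 0.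
  have [|_ [y yj yi]] := Pch (inord i) (inord i.+1); first by rewrite !inordK; lia.
  by exists (repr y); rewrite /J reprK; split=> //; apply/negP.
have [g gE] := choice gP.
have [|b Ab nb] := coord_small ltAd (gs := mkseq g d); first by rewrite size_mkseq.
have Jb : J 0%N b.
  rewrite [b]mpolyE; apply: (ideal_sum (JI _)) => m /Ab [v vA mv].
  rewrite -mul_mpolyC; apply: (idealM (JI _)).
  have -> : m = (m - U_(enum_rank v) + U_(enum_rank v))%MM.
    rewrite submK //; apply/mnm_lepP => i; rewrite mnm1E.
    by have [<-|] := eqVneq.
  rewrite mpolyXD; apply: (idealM (JI _)).
  by move: vA; rewrite inE negbK => /asboolP.
(* The chain is continued constantly after [d], since [nested_chain] expects an increasing family
   over all naturals. *)
pose J' i := J (minn i d).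
have := @nested_chain _ J' (mkseq g d) b 0.
rewrite add0n size_mkseq /J' minnn min0n => H; apply: (J1 d); apply: H Jb => //.
  move=> j x; have [ltjd|ledj] := ltnP j d.
    by rewrite (minn_idPl ltjd); apply: sub0.
  by rewrite (minn_idPr (leqW ledj)).
move=> j ltjd; rewrite add0n (minn_idPl ltjd) (minn_idPl (ltnW ltjd)) nth_mkseq //.
have [gj ngj] := gE j ltjd; split=> // x /Jprime [].
  by move/ngj.
by [].
Qed.

End EdgeIdeal.

(** * Independent sets and bounds on depth *)

Section IndependentSets.
Local Open Scope ring_scope.
Variables (K : fieldType) (V : finType) (e : rel V).
Local Notation S := {mpoly K[#|V|]}.
Local Notation edgeI := (@edge_ideal V e K).
Local Notation I := (fun x => x \in edgeI).
Hypotheses (e_sym : ssrbool.symmetric e) (e_irr : irreflexive e).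
Implicit Types (A : {set V}) (m : 'X_{1..#|V|}).

Definition max_indep A : Prop :=
  indep e A /\ forall v, v \notin A -> exists2 u, u \in A & e u v.

Lemma indep0 : indep e set0.
Proof. by move=> u v; rewrite inE. Qed.

Lemma indepU1 A v :
  indep e (v |: A) <-> indep e A /\ forall u, u \in A -> ~~ e u v.
Proof.
split=> [vA|[Ai vA] u w].
  by split=> [u w uA wA|u uA]; apply: vA; rewrite !inE ?uA ?wA ?eqxx ?orbT.
rewrite !inE => /orP[/eqP->|uA] /orP[/eqP->|wA]; rewrite ?e_irr //.
- by rewrite e_sym; apply: vA.
- exact: vA.
- exact: Ai.
Qed.

Lemma indep_extend A : indep e A -> exists2 B, max_indep B & A \subset B.
Proof.
move=> /asboolP Ai.
have [B /maxsetP [/asboolP Bi Bmax] AB] := maxset_exists (P := fun B => `[< indep e B >]) Ai.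
exists B => //; split=> // v vB; apply: contrapT => nv.
have vBi : indep e (v |: B).
  by apply/indepU1; split=> // u uB; apply/negP => euv; apply: nv; exists u.
by have := Bmax (v |: B) (introT (asboolP _) vBi) (subsetUr _ _) => vBB;
  rewrite -vBB setU11 in vB.
Qed.

Definition indicator A : 'X_{1..#|V|} :=
  [multinom (enum_val i \in A : nat) | i < #|V|].

Lemma mexp_indicator A v : mexp (indicator A) v = (v \in A).
Proof. by rewrite /mexp mnmE enum_rankK. Qed.

Lemma indep_indicator A : indep e A -> ~ has_edge e (indicator A).
Proof.
move=> Ai [u [v [euv]]]; rewrite !mexp_indicator !lt0b => uA vA.
by have := Ai u v uA vA; rewrite euv.
Qed.

Lemma max_indep_ann A b : max_indep A -> coord_ideal A b ->
  b * 'X_[indicator A] \in edgeI.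
Proof.
move=> [_ Amax] qb; apply/edge_idealE => //.
apply: (supportedM (U2 := fun m => m = indicator A) _ qb); last exact: supportedX.
move=> m1 _ [v vA m1v] ->; have [u uA euv] := Amax v vA.
by exists u, v; rewrite !mexpD !mexp_indicator uA; split=> //; lia.
Qed.

(** Otherwise [coord_ideal A] would contain an element nested in [s], hence a nonzerodivisor,
    although it kills the nonzero product of the variables in [A]. *)
Lemma regular_size_le A s : max_indep A -> (forall f, f \in s -> homog_pos f) ->
  reg I s -> (size s <= #|A|)%N.
Proof.
move=> Am hs rs; rewrite leqNgt; apply/negP => ltAs.
have [//|b qb nb] := coord_small ltAs (gs := s).
have := nested_nzd (edge_hideal K e_irr) hs rs nb (max_indep_ann Am qb).
move/edge_idealE => /(_ e_irr) uI; apply: (indep_indicator Am.1); apply: uI.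
by rewrite msuppX mem_head.
Qed.

(** The form in which Cohen-Macaulayness is used: the dimension, here the length of [s], is at least
    the size of any independent set. *)
Lemma cm_regular_seq : cohen_macaulay_graph e K ->
  exists s : seq S, [/\ forall f, f \in s -> homog_pos f, reg I s &
    forall A, indep e A -> (#|A| <= size s)%N].
Proof.
case=> d [[s /homog_regular_seqE [hs rs _] szs] _] [_ dmax].
exists s; split=> // A Ai; rewrite szs.
by have [P Pch] := krull_lower K e_irr Ai; apply: dmax Pch.
Qed.

(* Off the coordinate subspace of [A], the product [u] of the variables in [A]
   splits as a sum of two orthogonal fractions, one killed by [X] and one by
   [Y]. The first one becomes a ring element [u * p2] after multiplication by any
   [p = p1 + p2] in [coord_ideal A], where [p1] collects the monomials involving
   [X]. As [A] has codimension at least 2, depth forces the fraction itself to be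
   in the ring; it is the [r] below, and its coefficient at [u] would have to be
   both 0 and 1. *)
Lemma no_bipartite_link A (X Y : {set V}) a c s k :
    [disjoint X & A] -> [disjoint X & Y] ->
    (forall v, v \notin A -> (exists2 u, u \in A & e u v) \/ v \in X :|: Y) ->
    (forall x y, x \in X -> y \in Y -> e x y) ->
    a \in X -> c \in Y -> c \notin A -> indep e (a |: A) -> indep e (c |: A) ->
    (forall f, f \in s -> homog_pos f) -> reg I s -> size s = k.+1 ->
  ~ (#|A| < k)%N.
Proof.
move=> XA XY cover XYe aX cY cA aAi cAi hs rs szs ltAk.
have II := edge_hideal K e_irr; have [qI qH] := coord_hideal K A.
pose hasX m := exists2 x, x \in X & (0 < mexp m x)%N.
pose u : S := 'X_[indicator A].
(* A monomial of [u * p1] involves all of [A] and some [x] in [X]. One of [p2] involves some [v]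
   outside [A] and [X], which is adjacent to a vertex of [A], or lies in [Y] and is adjacent to
   [x]. *)
have uI p1 p2 : supported hasX p1 -> supported (fun m => ~ hasX m) p2 ->
    coord_ideal A p2 -> u * p1 * p2 \in edgeI.
  move=> Xp1 nXp2 qp2; apply/edge_idealE => //.
  have Up1 : supported (fun m => exists2 x, x \in X & (0 < mexp m x)%N /\
      forall v, v \in A -> (0 < mexp m v)%N) (u * p1).
    apply: (supportedM (U1 := fun m => m = indicator A) _ _ Xp1); last exact: supportedX.
    move=> _ m -> [x xX mx]; exists x => //.
    rewrite mexpD; split=> [|v vA]; first by lia.
    by rewrite mexpD mexp_indicator vA.
  have Up2 : supported (fun m => leaves A m /\ ~ hasX m) p2.
    by move=> m mp2; split; [apply: qp2 | apply: nXp2].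
  apply: (supportedM _ Up1 Up2) => m1 m2 [x xX [m1x m1A]] [[v vA m2v] nX].
  have [[w wA ewv]|] := cover v vA.
    have := m1A w wA => m1w.
    by exists w, v; rewrite !mexpD; split=> //; lia.
  rewrite inE => /orP[vX|vY]; first by case: nX; exists v.
  by exists x, v; rewrite !mexpD; split=> //; [apply: XYe | lia | lia].
have leX p : supported hasX p -> coord_ideal A p.
  move=> Xp m /Xp [x xX mx]; exists x => //.
  by rewrite (disjointFr XA xX).
have [b0 qb0 nb0] := coord_small (leqW ltAk) (gs := s) szs.
have [d nb] := nested_pihomog hs nb0.
have qb := qH d _ qb0; move: (pihomog mdeg d b0) nb qb => {b0 qb0 nb0} b nb qb.
have [b1 [b2 [bE Xb1 nXb2]]] := supported_split hasX b.
have qb2 : coord_ideal A b2.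
  have -> : b2 = b - b1 by rewrite bE; ring.
  by apply: (idealB qI) => //; apply: leX.
(* Equality of cross products: the fraction [u * s2 / (s1 + s2)] is the same as [u * b2 / b]. *)
have key s1 s2 : supported hasX s1 -> supported (fun m => ~ hasX m) s2 ->
    coord_ideal A s2 -> (s1 + s2) * (u * b2) - b * (u * s2) \in edgeI.
  move=> Xs1 nXs2 qs2; rewrite bE.
  have -> : (s1 + s2) * (u * b2) - (b1 + b2) * (u * s2) =
    u * s1 * b2 - u * b1 * s2 by ring.
  by apply: (idealB II.1); apply: uI.
(* By [key], all of [coord_ideal A] multiplies [u * b2] into [I + (b)], so [small_ann] makes the
   fraction an element [r]. *)
have [r Ir] : adj I b (u * b2).
  apply: (small_ann II qI hs rs szs nb (coord_small ltAk)) => t qt.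
  have [t1 [t2 [tE Xt1 nXt2]]] := supported_split hasX t.
  exists (u * t2); rewrite tE; apply: key => //.
  have -> : t2 = t - t1 by rewrite tE; ring.
  by apply: (idealB qI) => //; apply: leX.
have bI := nested_nzd II hs rs (hnested_nested nb).
pose za := vertex_var K a; pose zc := vertex_var K c.
have Xza : supported hasX za.
  by apply: supportedX; exists a => //; rewrite mexp1 eqxx.
(* Test the fraction on two denominators: [za] has zero part free of [X], giving [r * za = 0], while
   [zc] is entirely free of [X], giving [r * zc = u * zc]. *)
have ra : r * za \in edgeI.
  apply: bI.
  have := key za 0 Xza (@supported0 _ _ _) (ideal0 qI); rewrite addr0 => kza.
  have -> : b * (r * za) = (za * (u * b2) - b * (u * 0)) - za * (u * b2 - b * r).
    by ring.
  by apply: (idealB II.1) => //; apply: (idealM II.1).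
have nXzc : supported (fun m => ~ hasX m) zc.
  apply: supportedX => -[x xX]; rewrite mexp1; case: eqP => // cx.
  by rewrite -cx (disjointFl XY cY) in xX.
have rc : (r - u) * zc \in edgeI.
  apply: bI.
  have := key 0 zc (@supported0 _ _ _) nXzc (coord_var cA); rewrite add0r => kzc.
  have -> : b * ((r - u) * zc) = (zc * (u * b2) - b * (u * zc)) - zc * (u * b2 - b * r).
    by ring.
  by apply: (idealB II.1) => //; apply: (idealM II.1).
have coef v g : indep e (v |: A) -> g * vertex_var K v \in edgeI ->
    g@_(indicator A) = 0.
  move=> vAi /edge_idealE => /(_ e_irr) Ig; rewrite -(mcoeffMX g U_(enum_rank v)%MM).
  apply: (supported_coef Ig) => -[x [y [exy]]].
  rewrite !mexpD !mexp1 !mexp_indicator => mx my.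
  have inA z : (0 < (v == z) + (z \in A))%N -> z \in v |: A.
    by rewrite !inE eq_sym; case: eqP; case: (z \in A).
  by have := vAi x y (inA x mx) (inA y my); rewrite exy.
have /eqP := coef c _ cAi rc.
rewrite mcoeffB (coef a _ aAi ra) mcoeffX eqxx sub0r oppr_eq0.
by rewrite oner_eq0.
Qed.

End IndependentSets.

(** * The two parts of a bipartite graph *)

Lemma bipartition_sym (V : finType) (e : rel V) (V1 V2 : {set V}) :
  bipartition e V1 V2 -> bipartition e V2 V1.
Proof.
case=> V12 dis bip; split; [by rewrite setUC | by rewrite disjoint_sym |].
by move=> u v /bip; rewrite orbC.
Qed.

Lemma part_max_indep (V : finType) (e : rel V) (V1 V2 : {set V}) :
    ssrbool.symmetric e -> bipartition e V1 V2 ->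
    (forall v, 0 < #|nbhd e v|) ->
  max_indep e V1.
Proof.
move=> e_sym [V12 dis bip] e_deg; split=> [u v uV1 vV1|v vV1].
  by apply/negP => /bip; rewrite (disjointFr dis uV1) (disjointFr dis vV1) andbF.
have /card_gt0P [u] := e_deg v; rewrite inE => evu; exists u; last by rewrite e_sym.
by have := bip _ _ evu; rewrite (negPf vV1) => /andP[].
Qed.

(** * Hall's marriage theorem *)

Section Hall.
Variables (T : finType).
Implicit Types (N : T -> {set T}) (A W : {set T}).

(** The induction of Halmos and Vaughan on [#|A|], split by whether some nonempty proper subset is
    tight, that is, has exactly as many neighbours as elements. *)
Lemma hall N A : (forall W, W \subset A -> #|W| <= #|\bigcup_(w in W) N w|) ->
  exists f : T -> T, {in A &, injective f} /\ forall a, a \in A -> f a \in N a.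
Proof.
have [k] := ubnP #|A|; elim: k => // k IH in N A * => ltAk hallA.
have [->|[a aA]] := set_0Vmem A.
  by exists id; split=> [x y|x]; rewrite inE.
have glue W f g : W \subset A ->
    {in W &, injective f} -> (forall w, w \in W -> f w \in N w) ->
    {in A :\: W &, injective g} ->
    (forall x, x \in A :\: W -> g x \in N x /\ forall w, w \in W -> g x != f w) ->
    exists f : T -> T, {in A &, injective f} /\ forall a, a \in A -> f a \in N a.
  move=> WA finj fN ginj gN; exists (fun x => if x \in W then f x else g x).
  split=> [x y xA yA|x xA]; last first.
    case: ifP => xW; first exact: fN.
    by have [] := gN x; rewrite ?inE ?xW.
  case: ifP => xW; case: ifP => yW.
  - exact: finj.
  - have yAW : y \in A :\: W by rewrite inE yW.
    by have [_ /(_ x xW) /eqP neq] := gN y yAW; move=> /esym /neq.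
  - have xAW : x \in A :\: W by rewrite inE xW.
    by have [_ /(_ y yW) /eqP neq] := gN x xAW; move=> /neq.
  - by apply: ginj; rewrite inE ?xW ?yW.
(* A tight [W] is matched first and its neighbours are removed; the condition for [W' :|: W] then
   yields the one for [W'] in the rest. *)
have [/existsP [W /and4P[WA W0 WnA /eqP cW]]|noW] :=
    boolP [exists W : {set T}, [&& W \subset A, W != set0, W != A &
            #|W| == #|\bigcup_(w in W) N w|]].
  have ltWA : #|W| < #|A| by rewrite proper_card // properEneq WnA.
  have [||f [finj fN]] := IH N W; first by lia.
    by move=> W' W'W; apply: hallA; apply: subset_trans WA.
  pose NW := \bigcup_(w in W) N w.
  have [||g [ginj gN]] := IH (fun x => N x :\: NW) (A :\: W).
  - by rewrite cardsD (setIidPr WA); move: W0; rewrite -card_gt0; lia.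
  - move=> W' W'A; have dis : [disjoint W' & W].
      rewrite disjoint_subset; apply/subsetP => x /(subsetP W'A).
      by rewrite !inE => /andP[].
    have := hallA (W' :|: W); rewrite subUset WA andbT => /(_ (subset_trans W'A (subsetDl _ _))).
    rewrite cardsU disjoint_setI0 // cards0 subn0 bigcup_setU.
    suff -> : \bigcup_(w in W') N w :|: NW = \bigcup_(w in W') (N w :\: NW) :|: NW.
      have := leq_card_setU (\bigcup_(w in W') (N w :\: NW)) NW.
      by move=> [le _]; rewrite cW -/NW; lia.
    apply/setP => x; rewrite !inE; have [|xN] := boolP (x \in NW); rewrite ?orbT // !orbF.
    apply/bigcupP/bigcupP => -[w wW' xw]; exists w => //; first by rewrite inE xN.
    by move: xw; rewrite inE => /andP[].
  apply: (glue W f g) => // x /gN; rewrite inE => /andP[gNW gx]; split=> // w wW.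
  by apply: contraNneq gNW => ->; apply/bigcupP; exists w => //; apply: fN.
(* Without tight subsets there is always a spare neighbour, so [a] may take any [y]. *)
have [y yNa] : exists y, y \in N a.
  have := hallA [set a]; rewrite sub1set aA => /(_ isT).
  by rewrite big_set1 cards1 card_gt0 => /set0Pn.
have [||g [ginj gN]] := IH (fun x => N x :\ y) (A :\ a).
- by have := cardsD1 a A; rewrite aA; lia.
- move=> W WA.
  have [->|W0] := eqVneq W set0; first by rewrite cards0.
  have WsA : W \subset A := subset_trans WA (subsetDl _ _).
  have WnA : W != A.
    apply: contraTneq WA => ->; apply/negP => /subsetP /(_ a aA).
    by rewrite !inE eqxx.
  have := hallA W WsA.
  move: noW; rewrite negb_exists => /forallP /(_ W); rewrite WsA W0 WnA /= => neq.
  have -> : \bigcup_(w in W) (N w :\ y) = (\bigcup_(w in W) N w) :\ y.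
    apply/setP => z; rewrite !inE; apply/bigcupP/andP => [[w wW]|[zy /bigcupP [w wW zw]]].
      by rewrite !inE => /andP[-> zw]; split=> //; apply/bigcupP; exists w.
    by exists w => //; rewrite !inE zy.
  by have := cardsD1 y (\bigcup_(w in W) N w); case: (y \in _); lia.
apply: (glue [set a] (fun=> y) g) => //.
- by rewrite sub1set.
- by move=> u v; rewrite !inE => /eqP -> /eqP ->.
- by move=> w; rewrite inE => /eqP ->.
- by move=> x xA; have := gN x xA; rewrite !inE => /andP[? ?]; split.
Qed.

End Hall.

(** * A difference of two variables modulo a monomial ideal *)

Section MonomialDifference.
Local Open Scope ring_scope.
Variables (K : fieldType) (n : nat).
Local Notation S := {mpoly K[n]}.

(** Suppose the part of [h] outside [U] is nonzero and take in it a monomial [m] of largest degree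
    in variable [i]. Its product with that variable cannot cancel, so it lies in [U]. *)
Lemma supported_difference_nzd (U : 'X_{1..n} -> Prop) (i j : 'I_n) (h : S) :
    i != j ->
    (forall m m', U m -> U (m' + m)%MM) ->
    (forall m, U (m + U_(i) + U_(i))%MM -> U (m + U_(i))%MM) ->
    (forall m, U (m + U_(i))%MM -> U (m + U_(j))%MM -> U m) ->
  supported U (('X_i - 'X_j) * h) -> supported U h.
Proof.
move=> neq_ij Uup Usq Ucap Uh; have [UI _] := supported_hideal K Uup.
have [h1 [h2 [hE Uh1 nUh2]]] := supported_split U h.
have {Uh} Uh2 : supported U (h2 * 'X_i - h2 * 'X_j).
  have -> : h2 * 'X_i - h2 * 'X_j = ('X_i - 'X_j) * h - ('X_i - 'X_j) * h1.
    by rewrite hE; ring.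
  by apply: (idealB UI) => //; apply: (idealM UI).
suff -> : h = h1 by [].
rewrite hE; suff -> : h2 = 0 by rewrite addr0.
apply: msuppnil0; case E : (msupp h2) => [//|m0 s]; exfalso.
have m0h : m0 \in msupp h2 by rewrite E mem_head.
have [m mh mmax] : exists2 m, m \in msupp h2 &
    forall m', m' \in msupp h2 -> (m' i <= m i)%N.
  pose P d := has (fun m : 'X_{1..n} => m i == d) (msupp h2).
  have exP : exists d, P d by exists (m0 i); apply/hasP; exists m0.
  have [|d /hasP [m mh /eqP <-] dmax] :=
      ex_maxnP exP (m := \max_(m <- msupp h2) m i).
    by move=> d /hasP [m mh /eqP <-]; apply: leq_bigmax_seq.
  exists m => // m' m'h; apply: dmax; apply/hasP; by exists m'.
have h2m : h2@_m != 0 by rewrite -mcoeff_msupp.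
have coefX k l m' : (h2 * 'X_k)@_(m' + U_(l))%MM != 0 ->
    exists2 m'', m'' \in msupp h2 & (m' + U_(l) = U_(k) + m'')%MM.
  rewrite -mcoeff_msupp (perm_mem (msuppMX _ _)) => /mapP [m'' m''h ->].
  by exists m''.
have Umi : U (m + U_(i))%MM.
  apply: contrapT => /(supported_coef Uh2); rewrite mcoeffB [(m + _)%MM]addmC mcoeffMX.
  have [->|] := eqVneq ((h2 * 'X_j)@_(U_(i) + m)) 0.
    by rewrite subr0; apply/eqP.
  rewrite addmC => /coefX [m' m'h /mnmP /(_ i)]; rewrite !mnmDE !mnm1E eqxx.
  by rewrite eq_sym (negPf neq_ij) => H; have := mmax _ m'h; lia.
have nUm := nUh2 m mh.
(* So the product of [m] with variable [j] must cancel against some [m' + U_(i)]. Hence [m] is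
   divisible by variable [i], and the squarefreeness hypothesis brings [m] itself into [U]. *)
have nUmj : ~ U (m + U_(j))%MM by move=> /(Ucap _ Umi).
have := supported_coef Uh2 nUmj.
rewrite mcoeffB [X in _ - X](_ : _ = h2@_m); last by rewrite addmC mcoeffMX.
have [->|] := eqVneq ((h2 * 'X_i)@_(m + U_(j))%MM) 0.
  by rewrite sub0r => /eqP; rewrite oppr_eq0 (negPf h2m).
move=> /coefX [m' m'h /mnmP /(_ i)]; rewrite !mnmDE !mnm1E eqxx eq_sym (negPf neq_ij).
rewrite addn0 => mi _.
have mE : m = (m - U_(i) + U_(i))%MM.
  rewrite submK //; apply/mnm_lepP => k; rewrite mnm1E.
  by have [<-|] := eqVneq; rewrite ?mi.
by apply: nUm; rewrite mE; apply: Usq; rewrite -mE.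
Qed.

End MonomialDifference.

(** * From a matching with (1) and (2) to Cohen-Macaulayness *)

Section MatchedPosetGraph.
Local Open Scope ring_scope.
Variables (K : fieldType) (V : finType) (e : rel V) (V1 V2 : {set V}).
Local Notation S := {mpoly K[#|V|]}.
Local Notation edgeI := (@edge_ideal V e K).
Local Notation I := (fun x => x \in edgeI).
Local Notation var := (vertex_var K).
Hypotheses (e_sym : ssrbool.symmetric e) (e_irr : irreflexive e).
Hypothesis e_bip : bipartition e V1 V2.
Variables (n : nat) (x y : 'I_n -> V).
Hypotheses (xV1 : forall i, x i \in V1) (yV2 : forall i, y i \in V2).
Hypotheses (x_inj : injective x) (y_inj : injective y).
Hypothesis xy_cover : forall v, exists i, v = x i \/ v = y i.
Hypothesis xy_edge : forall i, e (x i) (y i).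
Hypothesis xy_trans : forall i u v, e (y i) u -> e (x i) v -> e u v.
Hypothesis xy_anti : forall i j, i != j -> e (x i) (y j) -> ~~ e (x j) (y i).

Lemma x_neq_y i j : x i != y j.
Proof.
have [_ /disjointFr dis _] := e_bip.
by apply: contraTneq (yV2 j) => <-; rewrite dis.
Qed.

Lemma edge_xy u v : e u v -> exists i j, e (x i) (y j) /\
  ((u = x i /\ v = y j) \/ (u = y j /\ v = x i)).
Proof.
have [_ /disjointFr dis bip] := e_bip => euv.
have [i ui] := xy_cover u; have [j vj] := xy_cover v.
have V1F k : (y k \in V1) = false by apply: contraTF (yV2 k) => /dis ->.
have V2F k : (x k \in V2) = false by rewrite dis.
have := bip u v euv; case: ui vj euv => -> [] -> euv;
  rewrite ?xV1 ?yV2 ?V1F ?V2F //= => _.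
  by exists i, j; split=> //; left.
by exists j, i; split; [rewrite e_sym | right].
Qed.

Definition theta i : S := var (x i) - var (y i).

(* Identifying [y i] with [x i] for [i] in [L] turns the quotient by the edge
   ideal and by [theta i], [i] in [L], into a quotient by a monomial ideal. *)
Definition collapse (L : seq 'I_n) (v : V) : V :=
  if [pick i in L | y i == v] is Some i then x i else v.

Lemma collapse_x L i : collapse L (x i) = x i.
Proof.
rewrite /collapse; case: pickP => // j /andP[_ /eqP yx].
by have := x_neq_y i j; rewrite yx eqxx.
Qed.

Lemma collapse_y L i : collapse L (y i) = if i \in L then x i else y i.
Proof.
rewrite /collapse; case: pickP => [j /andP[jL /eqP /y_inj ji]|].
  by rewrite -ji jL.
by move=> /(_ i); rewrite eqxx andbT => ->.
Qed.

Definition collapse_mpoly L (f : S) : S :=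
  f \mPo [tuple var (collapse L (enum_val i)) | i < #|V|].

Lemma collapse_var L v : collapse_mpoly L (var v) = var (collapse L v).
Proof.
by rewrite /collapse_mpoly /vertex_var comp_mpolyXU -tnth_nth tnth_mktuple enum_rankK.
Qed.

Definition collapsed_edge L (m : 'X_{1..#|V|}) : Prop :=
  exists i j, e (x i) (y j) /\
    (U_(enum_rank (x i)) + U_(enum_rank (collapse L (y j))) <= m)%MM.

Lemma collapsed_edgeD L m m' : collapsed_edge L m -> collapsed_edge L (m' + m)%MM.
Proof.
case=> i [j [eij le_m]]; exists i, j; split=> //.
by apply: lepm_trans le_m _; rewrite lem_addl.
Qed.

(** The substitution kills [theta i] for [i] in [L] and sends edges to collapsed edges. Conversely,
    any polynomial is congruent to its collapse modulo these [theta i], which is the predicate [D]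
    of the proof. *)
Lemma adjs_theta L f : adjs I [seq theta i | i <- L] f <->
  supported (collapsed_edge L) (collapse_mpoly L f).
Proof.
have [UI _] := supported_hideal K (@collapsed_edgeD L).
have AI : is_ideal (adjs I [seq theta i | i <- L]).
  exact/adjs_ideal/idealr_is_ideal.
have thetaA i : i \in L -> adjs I [seq theta i | i <- L] (theta i).
  by move=> iL; apply: adjs_gen; [apply: idealr_is_ideal | apply: map_f].
split.
  have cI : is_ideal (fun f => supported (collapsed_edge L) (collapse_mpoly L f)).
    split; rewrite /collapse_mpoly.
    - by rewrite comp_mpoly0; apply: supported0.
    - by move=> u v Uu Uv; rewrite comp_mpolyD; apply: supportedD.
    - by move=> a u Uu; rewrite rmorphM; apply: (idealM UI).
  apply: (adjs_min cI) => [g|_ /mapP [i iL ->]].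
    apply: (ideal_gen_min cI) => a /existsP [u /existsP [v /andP [euv /eqP ->]]].
    rewrite /collapse_mpoly rmorphM /= -!/(collapse_mpoly L _) !collapse_var.
    rewrite /vertex_var -mpolyXD; apply: supportedX.
    have [i [j [eij [[-> ->]|[-> ->]]]]] := edge_xy euv; exists i, j;
      split=> //; rewrite collapse_x; apply/mnm_lepP => k //.
    by rewrite addmC.
  rewrite /collapse_mpoly /theta raddfB /= -!/(collapse_mpoly L _) !collapse_var.
  by rewrite collapse_x collapse_y iL subrr; apply: supported0.
pose D g := adjs I [seq theta i | i <- L] (g - collapse_mpoly L g).
have Dvar v : D (var v).
  rewrite /D collapse_var; have [i [->|->]] := xy_cover v.
    by rewrite collapse_x subrr; apply: ideal0 AI.
  rewrite collapse_y; case: ifP => [iL|_]; last by rewrite subrr; apply: ideal0 AI.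
  by rewrite -opprB; apply: (idealN AI); apply: thetaA.
have DM g h : D g -> D h -> D (g * h).
  rewrite /D => Dg Dh; rewrite /collapse_mpoly rmorphM /= -!/(collapse_mpoly L _).
  have -> : g * h - collapse_mpoly L g * collapse_mpoly L h =
      h * (g - collapse_mpoly L g) + collapse_mpoly L g * (h - collapse_mpoly L h).
    by ring.
  by apply: (idealD AI); apply: (idealM AI).
have D1 : D 1 by rewrite /D /collapse_mpoly comp_mpoly1 subrr; apply: ideal0 AI.
have DX m : D 'X_[m].
  rewrite mpolyXE_id; elim/big_ind: _ => // i _.
  elim: (m i) => [|k IH]; first by rewrite expr0.
  by rewrite exprS; apply: DM => //; have := Dvar (enum_val i);
    rewrite /vertex_var enum_valK.
have Df : D f.
  rewrite [f]mpolyE; elim/big_ind: _ => [|g h Dg Dh|m _].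
  - by rewrite /D /collapse_mpoly comp_mpoly0 subrr; apply: ideal0 AI.
  - rewrite /D /collapse_mpoly comp_mpolyD opprD addrACA.
    exact: (idealD AI) Dg Dh.
  - rewrite /D /collapse_mpoly comp_mpolyZ -scalerBr -mul_mpolyC.
    by apply: (idealM AI); apply: DX.
move=> Uf; rewrite -[f](subrK (collapse_mpoly L f)); apply: (idealD AI) => //.
rewrite [collapse_mpoly L f]mpolyE; apply: (ideal_sum AI) => m /Uf [i [j [eij le_m]]].
rewrite -mul_mpolyC -(submK le_m) mpolyXD; do 2!apply: (idealM AI).
rewrite mpolyXD -!/(var _).
have -> : var (x i) * var (collapse L (y j)) =
    var (x i) * var (y j) - var (x i) * (var (y j) - var (collapse L (y j))) by ring.
apply: (idealB AI); first exact/adjs_sub/edge_var.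
by apply: (idealM AI); have := Dvar (y j); rewrite /D collapse_var.
Qed.

(** Since [p] is not in [L], collapsing leaves [theta p] unchanged and no collapsed edge contains
    [x p] twice, so [supported_difference_nzd] reduces the claim to an intersection condition on
    monomials. *)
Lemma theta_nzd L p g : p \notin L ->
  adjs I [seq theta i | i <- L] (theta p * g) -> adjs I [seq theta i | i <- L] g.
Proof.
move=> pL /adjs_theta Ug; apply/adjs_theta; move: Ug.
rewrite /collapse_mpoly rmorphM raddfB /= -!/(collapse_mpoly L _) !collapse_var.
rewrite collapse_x collapse_y (negPf pL).
have cyNx j : collapse L (y j) != x p.
  rewrite collapse_y; case: ifP => [jL|_]; last by rewrite eq_sym x_neq_y.
  by apply: contraNneq pL => /x_inj <-.
have cyE j : collapse L (y j) = y p -> j = p.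
  rewrite collapse_y; case: ifP => [_ xy|_ /y_inj //].
  by have := x_neq_y j p; rewrite xy eqxx.
have rkE u v : (enum_rank u == enum_rank v) = (u == v).
  by rewrite (inj_eq enum_rank_inj).
apply: supported_difference_nzd.
- by rewrite rkE x_neq_y.
- exact: collapsed_edgeD.
- move=> m [i [j [eij /mnm_lepP le_m]]]; exists i, j; split=> //.
  apply/mnm_lepP => k; have := le_m k; rewrite !mnmDE !mnm1E.
  have [<-|] := eqVneq (enum_rank (x p)) k; last by lia.
  by rewrite !rkE (negPf (cyNx j)); lia.
move=> m [i [j [eij /mnm_lepP lex]]] [i' [j' [eij' /mnm_lepP ley]]].
(* If no collapsed edge divides [m], the first edge must use [x p] and the second [y p]; [xy_trans]
   then joins the remaining ends [x i'] and [y j]. *)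
apply: contrapT => nm.
have ip : i = p.
  apply/eqP; apply: contra_notT nm => ip; exists i, j; split=> //.
  apply/mnm_lepP => k; have := lex k; rewrite !mnmDE !mnm1E.
  have [<-|] := eqVneq (enum_rank (x p)) k; last by rewrite addn0.
  by rewrite !rkE (negPf (cyNx j)) (inj_eq x_inj) (negPf ip).
have jp : j' = p.
  apply: cyE; apply/eqP; apply: contra_notT nm => jp; exists i', j'; split=> //.
  apply/mnm_lepP => k; have := ley k; rewrite !mnmDE !mnm1E.
  have [<-|] := eqVneq (enum_rank (y p)) k; last by rewrite addn0.
  by rewrite !rkE (negPf jp) (negPf (x_neq_y i' p)).
rewrite {}ip {i} in eij lex; rewrite {}jp {j'} in eij' ley.
have ei'j : e (x i') (y j) by apply: xy_trans eij; rewrite e_sym.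
apply: nm; exists i', j; split=> //; apply/mnm_lepP => k.
have := lex k; have := ley k; rewrite !mnmDE !mnm1E collapse_y (negPf pL) => leyk lexk.
(* Both ends divide [m], so their product does unless they coincide. That would mean [i' = j], with
   edges both ways between the pairs [j] and [p], against [xy_anti]. *)
suff neq : (enum_rank (x i') == k) && (enum_rank (collapse L (y j)) == k) = false.
  by move: neq leyk lexk; do 2!case: eqP => ? //=; lia.
apply/negP => /andP[/eqP <-]; rewrite rkE collapse_y.
case: ifP => [jL /eqP /x_inj ji|_]; last by rewrite eq_sym (negPf (x_neq_y _ _)).
have jp : j != p by apply: contraNneq pL => <-.
by have := xy_anti jp; rewrite ji => /(_ eij'); rewrite -ji eij.
Qed.

(** Sending a vertex to the index of its pair is injective on [A], and the image avoids [B]. *)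
Lemma indep_card_le (A : {set V}) (B : {set 'I_n}) : indep e A ->
    (forall i, i \in B -> x i \notin A /\ y i \notin A) -> (#|A| + #|B| <= n)%N.
Proof.
move=> Ai AB; have [g gE] := choice xy_cover.
have g_inj : {in A &, injective g}.
  have nxy i : x i \in A -> y i \in A -> false.
    by move=> xA yA; have := Ai _ _ xA yA; rewrite xy_edge.
  move=> u v uA vA guv; case: (gE u) (gE v) => uE [] vE.
  - by rewrite uE vE guv.
  - by have := nxy (g v); rewrite -{1}guv -uE -vE uA vA => /(_ isT isT).
  - by have := nxy (g v); rewrite -{2}guv -uE -vE uA vA => /(_ isT isT).
  - by rewrite uE vE guv.
rewrite -(card_in_imset g_inj) -[n in leqRHS]card_ord -(cardsC B) addnC leq_add2l.
apply: subset_leq_card; apply/subsetP => _ /imsetP [v vA ->]; rewrite inE.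
apply/negP => /AB [/negP xA /negP yA].
by case: (gE v) => vE; [apply: xA | apply: yA]; rewrite -vE.
Qed.

(** Depth and dimension are both [n]: the [theta i] are a regular sequence, the maximal independent
    set [V1] bounds the depth, and the largest independent sets have size [n], as the set of all
    [x i] shows. *)
Lemma matched_cohen_macaulay : (forall v, (0 < #|nbhd e v|)%N) ->
  cohen_macaulay_graph e K.
Proof.
move=> e_deg; have V1max := part_max_indep e_sym e_bip e_deg.
have le_n A : indep e A -> (#|A| <= n)%N.
  move=> Ai; rewrite -[#|A|]addn0 -(cards0 'I_n); apply: indep_card_le => // i.
  by rewrite inE.
exists n; split.
- exists [seq theta i | i <- enum 'I_n]; last by rewrite size_map size_enum_ord.
  apply/homog_regular_seqE; split.
  + move=> _ /mapP [i _ ->]; exists 1%N => //.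
    by apply: rpredB; rewrite dhomogX; apply/eqP; apply: mdeg1.
  + apply/reg_adjs => k; rewrite size_map => ltk g.
    have ltkn : (k < n)%N by rewrite size_enum_ord in ltk.
    pose p := nth (Ordinal ltkn) (enum 'I_n) k.
    rewrite (nth_map (Ordinal ltkn)) // -map_take; apply: theta_nzd.
    have := enum_uniq 'I_n; rewrite -{1}[enum 'I_n](cat_take_drop k) cat_uniq.
    case/and3P=> _ /hasPn dis _; apply: dis.
    by rewrite (drop_nth (Ordinal ltkn)) // mem_head.
  + move/adjs_theta; rewrite /collapse_mpoly comp_mpoly1 => /(_ 0%MM).
    rewrite msupp1 mem_head => /(_ isT) [i [j [_ /mnm_lepP /(_ (enum_rank (x i)))]]].
    by rewrite mnmDE !mnm1E mnm0E eqxx.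
- move=> s /homog_regular_seqE [hs rs _].
  exact: leq_trans (regular_size_le e_irr V1max hs rs) (le_n _ V1max.1).
- have cX : #|x @: [set: 'I_n]| = n by rewrite card_imset // cardsT card_ord.
  have := @krull_lower K V e e_irr (x @: [set: 'I_n]); rewrite cX; apply.
  move=> _ _ /imsetP [i _ ->] /imsetP [j _ ->].
  by apply: V1max.1.
- move=> d P /krull_upper [A Ai ledA].
  exact: leq_trans ledA (le_n A Ai).
Qed.

End MatchedPosetGraph.

(** * From Cohen-Macaulayness to the matching *)

Section CohenMacaulayMatching.
Variables (K : fieldType) (V : finType) (e : rel V) (V1 V2 : {set V}).
Hypotheses (e_sym : ssrbool.symmetric e) (e_irr : irreflexive e).
Hypothesis e_bip : bipartition e V1 V2.
Hypothesis e_deg : forall v : V, 0 < #|nbhd e v|.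

Lemma cohen_macaulay_matching : cohen_macaulay_graph e K ->
  exists (n : nat) (x y : 'I_n -> V),
    [/\ forall i, x i \in V1 /\ y i \in V2,
        injective (fun i => [set x i; y i]),
        perfect_matching e [set [set x i; y i] | i : 'I_n],
        forall i u v, u \in nbhd e (y i) -> v \in nbhd e (x i) -> e u v
      & forall i j, i != j -> e (x i) (y j) -> ~~ e (x j) (y i)].
Proof.
have [V12 dis bip] := e_bip => /(cm_regular_seq e_irr) [s [hs rs le_s]].
have bip' := bipartition_sym e_bip.
have V1max := part_max_indep e_sym e_bip e_deg.
have V2max := part_max_indep e_sym bip' e_deg.
have unmixed A : max_indep e A -> #|A| = size s.
  move=> Am; apply/eqP; rewrite eqn_leq le_s ?(regular_size_le e_irr Am hs rs) //.
  exact: Am.1.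
have V1F v : v \in V2 -> v \in V1 = false by move=> vV2; rewrite (disjointFl dis vV2).
have eV1 u v : u \in V1 -> e u v -> v \in V2.
  by move=> uV1 /bip; rewrite uV1 (disjointFr dis uV1) orbF.
have eV2 u v : u \in V2 -> e u v -> v \in V1.
  by move=> uV2 /bip; rewrite uV2 (disjointFl dis uV2) /=.
have [f [f_inj fN]] : exists f : V -> V, {in V1 &, injective f} /\
    forall a, a \in V1 -> f a \in nbhd e a.
  apply: hall => W WV1; pose N := \bigcup_(w in W) nbhd e w.
  have NV2 : N \subset V2.
    apply/bigcupsP => w wW; apply/subsetP => v; rewrite inE; apply: eV1.
    exact: (subsetP WV1).
  (* Replacing in [V2] the neighbours of [W] by [W] gives an independent set, which cannot be larger
     than [V2]: this is Hall's condition. *)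
  have WNi : indep e (W :|: (V2 :\: N)).
    move=> u v; rewrite !inE => /orP[uW|/andP[uN uV2]] /orP[vW|/andP[vN vV2]].
    - by apply: V1max.1; apply: (subsetP WV1).
    - by apply: contra vN => euv; apply/bigcupP; exists u; rewrite ?inE.
    - by apply: contra uN => euv; apply/bigcupP; exists v; rewrite ?inE // e_sym.
    - exact: V2max.1.
  have := le_s _ WNi; rewrite -(unmixed V2 V2max) cardsU disjoint_setI0.
    by rewrite cards0 subn0 cardsD (setIidPr NV2); have := subset_leq_card NV2; rewrite -/N; lia.
  apply: disjointWl WV1 _; apply: disjointWr dis; exact: subsetDl.
pose n := #|V1|; pose x (i : 'I_n) : V := enum_val i; pose y i := f (x i).
have xV1 i : x i \in V1 by apply: enum_valP.
have xy_edge i : e (x i) (y i) by have := fN _ (xV1 i); rewrite inE.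
have yV2 i : y i \in V2 by apply: eV1 (xy_edge i).
have x_inj : injective x by apply: enum_val_inj.
have y_inj : injective y by move=> i j /(f_inj _ _ (xV1 i) (xV1 j)) /x_inj.
have xNy i j : x i != y j.
  by apply: contraTneq (xV1 i) => ->; rewrite V1F.
have xy_cover v : exists i, v = x i \/ v = y i.
  have [vV1|vV1] := boolP (v \in V1).
    by exists (enum_rank_in vV1 v); left; rewrite /x enum_rankK_in.
  have vV2 : v \in V2 by have := in_setT v; rewrite -V12 inE (negPf vV1).
  have yE : y @: [set: 'I_n] = V2.
    apply/eqP; rewrite eqEcard card_imset // cardsT card_ord.
    rewrite (unmixed _ V2max) -(unmixed _ V1max) leqnn andbT.
    by apply/subsetP => _ /imsetP [i _ ->].
  by move: vV2; rewrite -yE => /imsetP [i _ ->]; exists i; right.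
have card_le := indep_card_le xy_cover xy_edge.
have xy_compl i u v : e (y i) u -> e (x i) v -> e u v.
  move=> eyu exv; apply: contraT => nuv.
  have uV1 := eV2 _ _ (yV2 i) eyu; have vV2 := eV1 _ _ (xV1 i) exv.
  (* A maximal independent set through nonadjacent [u] and [v] would miss the whole pair [i] and
     have fewer than [n] elements. *)
  have [|B Bm uvB] := @indep_extend V e e_sym e_irr (u |: [set v]).
    apply/indepU1 => //; split=> [a b|a]; rewrite !inE => /eqP ->.
      by move=> /eqP ->; rewrite e_irr.
    by rewrite e_sym.
  have uB : u \in B by apply: (subsetP uvB); rewrite !inE eqxx.
  have vB : v \in B by apply: (subsetP uvB); rewrite !inE eqxx orbT.
  have := card_le B [set i] Bm.1.
  rewrite cards1 (unmixed _ Bm) -(unmixed _ V1max) => H.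
  suff : n + 1 <= n by rewrite addn1 ltnn.
  apply: H => _ /set1P ->; split.
    by apply: contraL exv => xB; apply: Bm.1.
  by apply: contraL eyu => yB; apply: Bm.1.
exists n, x, y; split=> //.
- move=> i j ij; apply: x_inj.
  have : x i \in [set x j; y j] by rewrite -ij set21.
  by rewrite !inE (negPf (xNy i j)) orbF => /eqP.
- split.
  + by move=> _ /imsetP [i _ ->]; exists (x i), (y i).
  + move=> _ _ /imsetP [i _ ->] /imsetP [j _ ->] neq.
    have ij : i != j by apply: contraNneq neq => ->.
    rewrite disjoints_subset; apply/subsetP => v; rewrite !inE negb_or.
    case/orP=> /eqP ->.
      by rewrite (inj_eq x_inj) ij xNy.
    by rewrite eq_sym xNy (inj_eq y_inj).
  + move=> v; have [i vi] := xy_cover v; exists [set x i; y i].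
      exact: imset_f.
    by case: vi => ->; rewrite ?set21 ?set22.
- by move=> i u v; rewrite !inE; apply: xy_compl.
move=> i j neq_ij exiyj; apply/negP => exjyi.
(* A set [A] maximal for [P] provides the situation of [no_bipartite_link], with [X] and [Y] the
   vertices of either part that are neither in [A] nor adjacent to it. *)
pose P (A : {set V}) := `[< [/\ indep e (x i |: A), indep e (y i |: A),
  x i \notin A & y i \notin A] >].
have P0 : P set0.
  by apply/asboolP; split; rewrite ?inE //; apply/indepU1 => //; split;
    [exact: indep0 | move=> u; rewrite inE | exact: indep0 | move=> u; rewrite inE].
have [A /maxsetP [/asboolP [xAi yAi xA yA] Amax] _] := maxset_exists P0.
have /(indepU1 e_sym e_irr) [Ai xA'] := xAi.
have /(indepU1 e_sym e_irr) [_ yA'] := yAi.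
pose X := [set v in V1 | (v \notin A) && [forall u in A, ~~ e u v]].
pose Y := [set v in V2 | (v \notin A) && [forall u in A, ~~ e u v]].
have addA v : v \notin A -> (forall u, u \in A -> ~~ e u v) -> v != x i -> v != y i ->
    ~~ e v (x i) -> ~~ e v (y i) -> False.
  move=> vA Av vx vy evx evy.
  suff PvA : P (v |: A) by have := Amax _ PvA (subsetUr _ _) => AE;
    rewrite -AE setU11 in vA.
  have vAi : indep e (v |: A) by apply/indepU1.
  apply/asboolP; split.
  - apply/indepU1 => //; split=> // u; rewrite !inE => /orP[/eqP ->//|]; exact: xA'.
  - apply/indepU1 => //; split=> // u; rewrite !inE => /orP[/eqP ->//|]; exact: yA'.
  - by rewrite !inE negb_or eq_sym vx.
  - by rewrite !inE negb_or eq_sym vy.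
have Xy v : v \in X -> e (y i) v.
  rewrite !inE => /and3P[vV1 vA /forall_inP Av]; apply: contraT => nyv; exfalso.
  apply: (addA v) => //.
  - by apply: contraNneq nyv => ->; rewrite e_sym.
  - by apply: contraTneq vV1 => ->; rewrite V1F.
  - exact: V1max.1.
  - by rewrite e_sym.
have Yx v : v \in Y -> e (x i) v.
  rewrite !inE => /and3P[vV2 vA /forall_inP Av]; apply: contraT => nxv; exfalso.
  apply: (addA v) => //.
  - by apply: contraTneq (xV1 i) => <-; rewrite V1F.
  - by apply: contraNneq nxv => ->.
  - by rewrite e_sym.
  - exact: V2max.1.
(* The second pair enters here: [x j] is adjacent to [y i] and [y j] to [x i], so [A] misses both
   pairs and its codimension is at least 2. *)
have xjA : x j \notin A by apply: contraL exjyi => /yA'.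
have yjA : y j \notin A by apply: contraL exiyj => /xA'; rewrite e_sym.
have cardA : #|A| + 2 <= size s.
  have := card_le A [set i; j] Ai; rewrite cards2 neq_ij -(unmixed _ V1max).
  by apply=> l /set2P [] ->.
have szs : size s = (size s).-1.+1 by lia.
apply: (@no_bipartite_link K V e e_irr A X Y (x i) (y i) s (size s).-1) => //.
- rewrite disjoints_subset; apply/subsetP => v; rewrite !inE.
  by case/and3P.
- rewrite disjoints_subset; apply/subsetP => v; rewrite !inE.
  by case/and3P=> vV1 _ _; rewrite (disjointFr dis vV1).
- move=> v vA; have [/existsP [u /andP [uA euv]]|] := boolP [exists u, (u \in A) && e u v].
    by left; exists u.
  move=> nN; right; rewrite !inE vA.
  have -> : [forall u in A, ~~ e u v].
    apply/forall_inP => u uA; apply: contra nN => euv.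
    by apply/existsP; exists u; rewrite uA.
  by rewrite !andbT; have := in_setT v; rewrite -V12 inE.
- by move=> u v /Xy eyu /Yx exv; apply: xy_compl eyu exv.
- rewrite !inE xV1 xA; apply/forall_inP => u; exact: xA'.
- rewrite !inE yV2 yA; apply/forall_inP => u; exact: yA'.
- by lia.
Qed.

End CohenMacaulayMatching.

Theorem theorem1 (K : fieldType) (V : finType) (e : rel V) (V1 V2 : {set V})
    (e_sym : ssrbool.symmetric e) (e_irr : irreflexive e)
    (e_bip : bipartition e V1 V2)
    (e_deg : forall v : V, 0 < #|nbhd e v|) :
  cohen_macaulay_graph e K <->
  exists (n : nat) (x y : 'I_n -> V),
    [/\ forall i, x i \in V1 /\ y i \in V2,
        injective (fun i => [set x i; y i]),
        perfect_matching e [set [set x i; y i] | i : 'I_n],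
        forall i u v, u \in nbhd e (y i) -> v \in nbhd e (x i) -> e u v
      & forall i j, i != j -> e (x i) (y j) -> ~~ e (x j) (y i)].
Proof.
split; first exact: cohen_macaulay_matching e_deg.
case=> n [x [y [xyV xy_inj [edgeM disM coverM] xy_compl xy_anti]]].
have memM i : [set x i; y i] \in [set [set x i; y i] | i : 'I_n] by apply: imset_f.
have disj i j : i != j -> [disjoint [set x i; y i] & [set x j; y j]].
  by move=> ij; apply: disM => //; apply: contraNneq ij => /xy_inj ->.
apply: (@matched_cohen_macaulay K V e V1 V2 e_sym e_irr e_bip n x y) => //.
- by move=> i; have [] := xyV i.
- by move=> i; have [] := xyV i.
- move=> i j xij; apply/eqP; apply: contraT => /disj /disjointFr /(_ (set21 _ _)).
  by rewrite xij set21.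
- move=> i j yij; apply/eqP; apply: contraT => /disj /disjointFr /(_ (set22 _ _)).
  by rewrite yij set22.
- move=> v; have [_ /imsetP [i _ ->]] := coverM v.
  by case/set2P => ->; exists i; [left | right].
- move=> i; have [u [v [euv]]] := edgeM _ (memM i).
  have [xV1 yV2] := xyV i; have [_ /disjointFr dis _] := e_bip => E.
  have xy : x i != y i by apply: contraTneq yV2 => <-; rewrite dis.
  have : x i \in [set u; v] by rewrite -E set21.
  have : y i \in [set u; v] by rewrite -E set22.
  case/set2P=> yE /set2P[] xE; move: xy; rewrite xE yE ?eqxx // => _.
  by rewrite e_sym.
- move=> i u v yu xv; apply: (xy_compl i); by rewrite inE.
Qed.
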